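(* Let $G$ be an infinite finitely generated nilpotent non-abelian group, and let $k\ge 2$. Let $\rho_n$ denote frequencies in balls of $G_X$, $X=\{x_1,\dots,x_k\}$, with respect to the norm $\|\cdot\|$ coming from a lower central base $e$ of $G_X$ extending a lower central base of $G$ (as described in the context). Then $$\liminf_{n\to\infty}\rho_n(SAT(G,k)) \ \geq\ \frac{1}{t(G)}\,\frac{\zeta(k+h(G))}{\zeta(k)},$$ where $h(G)$ is the Hirsch length of $G$ and $t(G)$ is the order of lower central torsion of $G$; and $$\limsup_{n\to\infty}\rho_n(SAT(G,k)) \ \leq\ \frac{\zeta(k+m)}{\zeta(k)},$$ where $m$ is the torsion-free rank (Hirsch length) of the abelianization $G/[G,G]$.
   Context: $\gamma_i(H)$ denotes the $i$-th term of the lower central series of a group $H$ ($\gamma_1(H)=H$, $\gamma_{i+1}(H)=[\gamma_i(H),H]$). Let $c$ be the nilpotency class of $G$ and $G_i=\gamma_i(G)$. **Space of equations.** Let $X=\{x_1,\dots,x_k\}$, let $F(X)$ be the free group on $X$, and let $N_c(X)=F(X)/\gamma_{c+1}(F(X))$ be the free nilpotent group of class $c$ on $X$. Put $G_X=(G*N_c(X))/\gamma_{c+1}(G*N_c(X))$, the free product of $G$ and $N_c(X)$ in the variety of nilpotent groups of class $\le c$. $G$ and $N_c(X)$ embed naturally in $G_X$. Elements $u\in G_X$ are viewed as equations $u=1$ in variables $x_1,\dots,x_k$ with coefficients in $G$. $SAT(G,k)\subseteq G_X$ is the set of $u$ for which $u=1$ has a solution in $G$, i.e. there are $h_1,\dots,h_k\in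 G$ such that the homomorphism $G_X\to G$ that is the identity on $G$ and sends $x_j\mapsto h_j$ maps $u$ to $1$. **Bases.** A base of a finitely generated abelian group $C$ is a tuple $(c_1,\dots,c_s,c'_1,\dots,c'_t)$ such that $C$ is the direct product of the cyclic subgroups generated by these elements, where the $c_i$ have infinite order and the $c'_j$ have finite orders. For each $i=1,\dots,c$ let $d_i$ be a tuple of elements of $G_i$ whose image in $G_i/G_{i+1}$ is a base of $G_i/G_{i+1}$; the concatenation $a=d_1d_2\cdots d_c$ is called a lower central base of $G$. For each $i$, the image of $G_i$ in $\gamma_i(G_X)/\gamma_{i+1}(G_X)$ is isomorphic to $G_i/G_{i+1}$ and is a direct summand: $\gamma_i(G_X)/\gamma_{i+1}(G_X)=G_i/G_{i+1}\times B_i$ for some complement $B_i$. Let $b_i$ be a tuple of elements of $\gamma_i(G_X)$ whose image is a base of $B_i$, where for $i=1$ one takes $B_1$ to be the (free abelian) subgroup generated by the image of $X$ and $b_1=(x_1,\dots,x_k)$. Fix the tuple $e=(b_1d_1)(b_2d_2)\cdots(b_cd_c)$ (concatenation); it is a lower central base of $G_X$ extending $a$. Write $e=(x_1,\dots,x_k,f_1,\dots,f_p)$, where $(f_1,\dots,f_p)=d_1(b_2d_2)\cdots(b_cd_c)$. If $f_s$ belongs to $b_i$ or $d_i$, let $\omega(f_s)\in\mathbb{N}\cup\{\infty\}$ be the order of the image of $f_s$ in $\gamma_i(G_X)/\gamma_{i+1}(G_X)$. Put $\mathbb{Z}_{\omega}=\mathbb{Z}$ if $\omega=\infty$ and $\mathbb{Z}_\omega=\{0,1,\dots,\omega-1\}$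 if $\omega$ is finite. **Norm and density.** Every $u\in G_X$ is uniquely written as $u=x_1^{\gamma_1}\cdots x_k^{\gamma_k}f_1^{\delta_1}\cdots f_p^{\delta_p}$ with $\gamma_j\in\mathbb{Z}$, $\delta_s\in\mathbb{Z}_{\omega(f_s)}$. The norm is $\|u\|=\max\{|\gamma_1|,\dots,|\gamma_k|,|\delta_1|,\dots,|\delta_p|\}$ and $B_n=\{u\in G_X:\|u\|\le n\}$ (a finite set). For $S\subseteq G_X$, $\rho_n(S)=|S\cap B_n|/|B_n|$. **Invariants.** $t(G)$, the order of lower central torsion of $G$, is the product of all the finite orders (in the respective quotients $G_i/G_{i+1}$) of elements of the lower central base $a$; equivalently, the product over $i=1,\dots,c$ of the orders of the torsion subgroups of $G_i/G_{i+1}$. The Hirsch length $h(G)$ is the number of infinite cyclic factors in a polycyclic series of $G$. $\zeta$ is the Riemann zeta function. *)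

(* Defs.v *)
From HB Require Import structures.
From mathcomp Require Import all_boot all_order all_algebra finmap.
From mathcomp Require Import all_classical all_reals all_analysis.
Set Implicit Arguments.
Unset Strict Implicit.
Unset Printing Implicit Defensive.

Import numFieldNormedType.Exports.

Local Open Scope classical_set_scope.
Local Open Scope group_scope.
Local Open Scope quotient_scope.

Definition expgz (G : groupType) (x : G) (z : int) : G :=
  match z with Posz n => x ^+ n | Negz n => x ^- n.+1 end.

(* The order of x, with 0 standing for infinity. *)
Definition elt_order (G : groupType) (x : G) : nat :=
  if pselect (exists n, (0 < n)%N && (x ^+ n == 1)) is left h
  then ex_minn h else 0%N.

Definition is_subgroup (G : groupType) (A : set G) : Prop :=
  A 1 /\ forall x y, A x -> A y -> A (x / y).

Definition is_normal (G : groupType) (A : set G) : Prop :=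
  is_subgroup A /\ forall x y, A x -> A (x ^ y).

Definition generated (G : groupType) (S : set G) : set G :=
  [set x | forall A, is_subgroup A -> S `<=` A -> A x].

Definition normal_closure (G : groupType) (S : set G) : set G :=
  [set x | forall A, is_normal A -> S `<=` A -> A x].

Definition finitely_generated (G : groupType) : Prop :=
  exists s : seq G, generated [set` s] = setT.

Definition commutator_subgroup (G : groupType) (A B : set G) : set G :=
  generated [set z | exists x y, [/\ A x, B y & z = [~ x, y]]].

(* As for finite groups in MathComp, indices start at 1; [gamma G 0] is
   a copy of [gamma G 1]. *)
Definition gamma (G : groupType) (i : nat) : set G :=
  iter i.-1 (fun A => commutator_subgroup A setT) setT.
Arguments gamma G i : clear implicits.

Definition nilpotency_class (G : groupType) (c : nat) : Prop :=
  gamma G c.+1 = [set 1] /\ forall j, gamma G j.+1 = [set 1] -> (c <= j)%N.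

Record normal_subgroup (G : groupType) := NormalSubgroup {
  nsub_set : set G;
  nsubP : is_normal nsub_set }.

Section SubgroupFacts.
Variable G : groupType.
Implicit Types (A S : set G) (x y : G).

Lemma subgroupV A x : is_subgroup A -> A x -> A x^-1.
Proof. by move=> [A1 AB] Ax; rewrite -[x^-1]mul1g; exact: AB. Qed.

Lemma subgroupM A x y : is_subgroup A -> A x -> A y -> A (x * y).
Proof.
by move=> sA Ax Ay; rewrite -[y]invgK; apply: sA.2 => //; exact: subgroupV.
Qed.

Lemma generated_subgroup S : is_subgroup (generated S).
Proof.
split=> [A [A1 _] _ //|x y Sx Sy A sA SA].
by apply: sA.2; [exact: Sx | exact: Sy].
Qed.

Lemma sub_generated S : S `<=` generated S.
Proof. by move=> x Sx A _; exact. Qed.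

Lemma normal_closure_normal S : is_normal (normal_closure S).
Proof.
split; first split=> [A [[A1 _] _] _ //|x y Sx Sy A nA SA].
  by apply: nA.1.2; [exact: Sx | exact: Sy].
by move=> x y Sx A nA SA; apply: nA.2; exact: Sx.
Qed.

Lemma generated_normal S :
  (forall x y, S x -> generated S (x ^ y)) -> is_normal (generated S).
Proof.
move=> SJ; split=> [|x y Sx]; first exact: generated_subgroup.
apply: (Sx [set z | generated S (z ^ y)]) => [|z Sz]; last exact: SJ.
split=> [|u v] /=; first by rewrite conj1g; exact: (generated_subgroup S).1.
by rewrite conjMg conjVg; exact: (generated_subgroup S).2.
Qed.

Lemma gamma_normal i : is_normal (gamma G i).
Proof.
rewrite /gamma; elim: i.-1 => {i} [|i IHi] /=; first by split.
apply: generated_normal => _ z [x [y [Ax _ ->]]].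
apply: sub_generated; exists (x ^ z), (y ^ z); split=> //; last exact: conjRg.
exact: IHi.2.
Qed.

Definition gammaN i := NormalSubgroup (gamma_normal i).
Definition normal_closureN S := NormalSubgroup (normal_closure_normal S).

End SubgroupFacts.

Section Quotient.
Variables (G : groupType) (N : normal_subgroup G).

Definition quot_rel : rel G := fun x y => `[< nsub_set N (x^-1 * y) >].

Lemma quot_relP : equiv_class_of quot_rel.
Proof.
have [sN _] := nsubP N; split=> [x|x y|y x z].
- by apply/asboolP; rewrite mulVg; exact: sN.1.
- by apply: asbool_equiv_eq; split=> /(subgroupV sN); rewrite invgM invgK.
- move=> /asboolP xy /asboolP yz; apply/asboolP.
  by have := subgroupM sN xy yz; rewrite mulgA mulgK.
Qed.

Canonical quot_equiv := EquivRelPack quot_relP.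

Definition quotient : Type := {eq_quot quot_rel}.
HB.instance Definition _ := Choice.on quotient.
HB.instance Definition _ := EqQuotient.on quotient.

Definition coset (x : G) : quotient := \pi_quotient x.

Lemma coset_eqP x y : coset x = coset y <-> nsub_set N (x^-1 * y).
Proof.
split=> [/(@eqquotP _ _ quotient)/asboolP //|Nxy].
by apply/(@eqquotP _ _ quotient)/asboolP.
Qed.

Lemma coset_repr (u : quotient) : coset (repr u) = u.
Proof. exact: reprK. Qed.

Definition quot_one : quotient := coset 1.
Definition quot_mul (u v : quotient) : quotient := coset (repr u * repr v).
Definition quot_inv (u : quotient) : quotient := coset (repr u)^-1.

Lemma coset_mul x y : quot_mul (coset x) (coset y) = coset (x * y).
Proof.
have [sN nN] := nsubP N; apply/coset_eqP.
have hx := (coset_eqP (repr (coset x)) x).1 (coset_repr _).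
have hy := (coset_eqP (repr (coset y)) y).1 (coset_repr _).
set a := repr (coset x) in hx *; set b := repr (coset y) in hy *.
have -> : (a * b)^-1 * (x * y) = (a^-1 * x) ^ b * (b^-1 * y).
  by rewrite /conjg invgM !mulgA mulgK.
by apply: subgroupM => //; exact: nN.
Qed.

Lemma coset_inv x : quot_inv (coset x) = coset x^-1.
Proof.
have [sN nN] := nsubP N; apply/coset_eqP.
have hx := (coset_eqP (repr (coset x)) x).1 (coset_repr _).
set a := repr (coset x) in hx *; rewrite invgK.
have -> : a * x^-1 = ((a^-1 * x)^-1) ^ a^-1.
  by rewrite /conjg invgM !invgK !mulgA mulgK.
by apply: nN; exact: subgroupV.
Qed.

Lemma quot_mulA : associative quot_mul.
Proof.
move=> u v w; rewrite -[u]coset_repr -[v]coset_repr -[w]coset_repr.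
by rewrite !coset_mul mulgA.
Qed.
Lemma quot_mul1g : left_id quot_one quot_mul.
Proof. by move=> u; rewrite -[u]coset_repr coset_mul mul1g. Qed.
Lemma quot_mulg1 : right_id quot_one quot_mul.
Proof. by move=> u; rewrite -[u]coset_repr coset_mul mulg1. Qed.
Lemma quot_mulVg : left_inverse quot_one quot_inv quot_mul.
Proof. by move=> u; rewrite -[u]coset_repr coset_inv coset_mul mulVg. Qed.
Lemma quot_mulgV : right_inverse quot_one quot_inv quot_mul.
Proof. by move=> u; rewrite -[u]coset_repr coset_inv coset_mul mulgV. Qed.

HB.instance Definition _ := isGroup.Build quotient
  quot_mulA quot_mul1g quot_mulg1 quot_mulVg quot_mulgV.

Lemma cosetM : {morph coset : x y / x * y}.
Proof. by move=> x y; rewrite -coset_mul. Qed.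

HB.instance Definition _ := isMultiplicative.Build G quotient coset cosetM.

End Quotient.

Section FreeGroup.
Variable X : choiceType.

(* The letter (x, false) is x, the letter (x, true) is its formal inverse. *)
Definition word := seq (X * bool).

Inductive word_eq : word -> word -> Prop :=
| word_eq_refl u : word_eq u u
| word_eq_sym u v : word_eq u v -> word_eq v u
| word_eq_trans u v w : word_eq u v -> word_eq v w -> word_eq u w
| word_eq_cancel u v x b :
    word_eq (u ++ [:: (x, b), (x, ~~ b) & v]) (u ++ v).

Definition word_inv (u : word) : word := rev [seq (l.1, ~~ l.2) | l <- u].

Lemma word_eq_cat u u' v v' :
  word_eq u u' -> word_eq v v' -> word_eq (u ++ v) (u' ++ v').
Proof.
move=> uu' vv'; apply: (@word_eq_trans _ (u' ++ v)).
  elim: uu' => {u u'} [u|u u' _|u u' u'' _ + _|u w x b].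
  - exact: word_eq_refl.
  - exact: word_eq_sym.
  - exact: word_eq_trans.
  - by rewrite -!catA /=; exact: word_eq_cancel.
elim: vv' => {v v'} [v|v v' _|v v' v'' _ + _|v w x b].
- exact: word_eq_refl.
- exact: word_eq_sym.
- exact: word_eq_trans.
- by rewrite !catA; exact: word_eq_cancel.
Qed.

Lemma word_eq_inv u v : word_eq u v -> word_eq (word_inv u) (word_inv v).
Proof.
elim=> {u v} [u|u v _|u v w _ + _|u v x b].
- exact: word_eq_refl.
- exact: word_eq_sym.
- exact: word_eq_trans.
rewrite /word_inv !map_cat !rev_cat /= !rev_cons -!cats1 -!catA /= negbK.
exact: word_eq_cancel.
Qed.

Lemma word_invK : involutive word_inv.
Proof.
move=> u; rewrite /word_inv map_rev revK -map_comp map_id_in // => -[x b] _ /=.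
by rewrite negbK.
Qed.

Lemma word_mulgV u : word_eq (u ++ word_inv u) [::].
Proof.
elim: u => [|[x b] u IHu] /=; first exact: word_eq_refl.
rewrite /word_inv /= rev_cons -cats1 catA -cat1s.
apply: (@word_eq_trans _ ([:: (x, b)] ++ [::] ++ [:: (x, ~~ b)])); last first.
  exact: (word_eq_cancel [::]).
apply: word_eq_cat; first exact: word_eq_refl.
by apply: word_eq_cat => //; exact: word_eq_refl.
Qed.

Definition free_rel : rel word := fun u v => `[< word_eq u v >].

Lemma free_relP : equiv_class_of free_rel.
Proof.
split=> [u|u v|v u w].
- by apply/asboolP; exact: word_eq_refl.
- by apply: asbool_equiv_eq; split; exact: word_eq_sym.
- move=> /asboolP uv /asboolP vw; apply/asboolP; exact: word_eq_trans vw.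
Qed.

Canonical free_equiv := EquivRelPack free_relP.

Definition free_group : Type := {eq_quot free_rel}.
HB.instance Definition _ := Choice.on free_group.
HB.instance Definition _ := EqQuotient.on free_group.

Definition of_word (u : word) : free_group := \pi_free_group u.

Lemma of_wordP u v : of_word u = of_word v <-> word_eq u v.
Proof.
split=> [/(@eqquotP _ _ free_group)/asboolP //|uv].
by apply/(@eqquotP _ _ free_group)/asboolP.
Qed.

Lemma of_word_repr (u : free_group) : of_word (repr u) = u.
Proof. exact: reprK. Qed.

Definition free_one := of_word [::].
Definition free_mul (u v : free_group) := of_word (repr u ++ repr v).
Definition free_inv (u : free_group) := of_word (word_inv (repr u)).

Lemma of_word_mul u v : free_mul (of_word u) (of_word v) = of_word (u ++ v).
Proof. by apply/of_wordP/word_eq_cat; apply/of_wordP; rewrite of_word_repr. Qed.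

Lemma of_word_inv u : free_inv (of_word u) = of_word (word_inv u).
Proof. by apply/of_wordP/word_eq_inv/of_wordP; rewrite of_word_repr. Qed.

Lemma free_mulA : associative free_mul.
Proof.
move=> u v w; rewrite -[u]of_word_repr -[v]of_word_repr -[w]of_word_repr.
by rewrite !of_word_mul catA.
Qed.
Lemma free_mul1g : left_id free_one free_mul.
Proof. by move=> u; rewrite -[u]of_word_repr of_word_mul. Qed.
Lemma free_mulg1 : right_id free_one free_mul.
Proof. by move=> u; rewrite -[u]of_word_repr of_word_mul cats0. Qed.
Lemma free_mulgV : right_inverse free_one free_inv free_mul.
Proof.
move=> u; rewrite -[u]of_word_repr of_word_inv of_word_mul.
exact/of_wordP/word_mulgV.
Qed.
Lemma free_mulVg : left_inverse free_one free_inv free_mul.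
Proof.
move=> u; rewrite -[u]of_word_repr of_word_inv of_word_mul.
by apply/of_wordP; rewrite -{2}[repr u]word_invK; exact: word_mulgV.
Qed.

HB.instance Definition _ := isGroup.Build free_group
  free_mulA free_mul1g free_mulg1 free_mulVg free_mulgV.

Definition free_gen (x : X) : free_group := of_word [:: (x, false)].

End FreeGroup.

(* The free product is presented by the generators [G + H] and the
   multiplication tables of [G] and [H]. *)
Definition free_product_relators (G H : groupType) :
    set (free_group (G + H)%type) :=
  [set r | (exists x y : G, r = free_gen (inl x) * free_gen (inl y)
                                / free_gen (inl (x * y)))
        \/ (exists x y : H, r = free_gen (inr x) * free_gen (inr y)
                                / free_gen (inr (x * y)))].

Definition free_product (G H : groupType) : groupType :=
  quotient (normal_closureN (free_product_relators (G := G) (H := H))).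

Definition fprod_inl (G H : groupType) (x : G) : free_product G H :=
  coset _ (free_gen (inl x)).
Definition fprod_inr (G H : groupType) (y : H) : free_product G H :=
  coset _ (free_gen (inr y)).

Definition free_nilpotent (c k : nat) : groupType :=
  quotient (gammaN (free_group 'I_k) c.+1).

Definition eqn_group (G : groupType) (c k : nat) : groupType :=
  quotient (gammaN (free_product G (free_nilpotent c k)) c.+1).

Definition eqn_const (G : groupType) (c k : nat) (g : G) : eqn_group G c k :=
  coset _ (fprod_inl _ g).
Definition eqn_var (G : groupType) (c k : nat) (j : 'I_k) : eqn_group G c k :=
  coset _ (fprod_inr _ (coset _ (free_gen j))).

Definition SAT (G : groupType) (c k : nat) : set (eqn_group G c k) :=
  [set u | exists (h : 'I_k -> G) (phi : {multiplicative eqn_group G c k -> G}),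
     [/\ forall g, phi (eqn_const c k g) = g,
         forall j, phi (eqn_var G c j) = h j & phi u = 1]].
Arguments SAT G c k : clear implicits.

(* [C] is the internal direct product of the subgroups listed in [Hs]. *)
Definition is_direct_product (K : groupType) (C : set K) (Hs : seq (set K)) :=
  let n := size Hs in
  let H (i : 'I_n) := nth set0 Hs i in
  [/\ forall i, is_subgroup (H i),
      forall i j x y, i != j -> H i x -> H j y -> commute x y,
      C = [set x | exists2 f : 'I_n -> K, forall i, H i (f i)
                                        & x = \prod_(i < n) f i]
    & forall f f' : 'I_n -> K,
        (forall i, H i (f i)) -> (forall i, H i (f' i)) ->
        \prod_(i < n) f i = \prod_(i < n) f' i -> f =1 f'].

Definition is_base (K : groupType) (C : set K) (s : seq K) : Prop :=
  (exists s1 s2, [/\ s = s1 ++ s2,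
                     {in s1, forall x, elt_order x = 0%N}
                   & {in s2, forall x, (0 < elt_order x)%N}])
  /\ is_direct_product C [seq range (expgz x) | x <- s].

(* gamma_i / gamma_{i+1}, as a subgroup of G / gamma_{i+1} *)
Definition lc_factor (G : groupType) (i : nat) :
    set (quotient (gammaN G i.+1)) :=
  [set coset _ x | x in gamma G i].
Arguments lc_factor G i : clear implicits.

Definition omega (G : groupType) (i : nat) (y : G) : nat :=
  elt_order (coset (gammaN G i.+1) y).

Definition lower_central_base (G : groupType) (c : nat) (d : nat -> seq G) :=
  forall i, (0 < i <= c)%N ->
    {in d i, forall y, gamma G i y} /\
    is_base (lc_factor G i) [seq coset _ y | y <- d i].

Definition lc_torsion (G : groupType) (c : nat) (d : nat -> seq G) : nat :=
  (\prod_(1 <= i < c.+1) \prod_(y <- d i | omega i y != 0) omega i y)%N.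

Definition vars (G : groupType) (c k : nat) : seq (eqn_group G c k) :=
  [seq eqn_var G c j | j <- enum 'I_k].

Definition complement_base (G : groupType) (c k : nat)
    (b : nat -> seq (eqn_group G c k)) : Prop :=
  b 1%N = vars G c k /\
  forall i, (0 < i <= c)%N ->
    exists B : set (quotient (gammaN (eqn_group G c k) i.+1)),
    [/\ is_direct_product (lc_factor (eqn_group G c k) i)
          [:: [set coset _ (eqn_const c k g) | g in gamma G i]; B],
        {in b i, forall y, gamma (eqn_group G c k) i y}
      & is_base B [seq coset _ y | y <- b i]].

(* The base e = (b_1 d_1) ... (b_c d_c), each element being paired with the
   bound of its exponents in normal forms: 0 (no bound) for the variables, and
   the order omega(f_s) for the elements f_s of d_1 (b_2 d_2) ... (b_c d_c). *)
Definition eqn_base (G : groupType) (c k : nat) (d : nat -> seq G)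
    (b : nat -> seq (eqn_group G c k)) : seq (eqn_group G c k * nat) :=
  let dX i := [seq eqn_const c k y | y <- d i] in
  let withw i s := [seq (y, omega i y) | y <- s] in
  [seq (x, 0%N) | x <- vars G c k] ++ withw 1%N (dX 1%N) ++
  flatten [seq withw i (b i ++ dX i) | i <- iota 2 c.-1].

Definition in_Zomega (w : nat) (z : int) : bool :=
  (w == 0%N) || (0 <= z < w%:Z)%R.

Section Norm.
Variables (K : groupType) (e : seq (K * nat)).

Definition normal_form (u : K) (z : seq int) : Prop :=
  [/\ size z = size e,
      all (fun p => in_Zomega p.1.2 p.2) (zip e z)
    & u = \prod_(p <- zip e z) expgz p.1.1 p.2].

Definition coords (u : K) : seq int := xget [::] [set z | normal_form u z].

Definition norm (u : K) : nat := (\max_(z <- coords u) `|z|)%N.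

Definition norm_ball (n : nat) : set K := [set u | (norm u <= n)%N].

Definition rho (R : realType) (S : set K) (n : nat) : R :=
  ((#|` fset_set (S `&` norm_ball n)|)%:R / (#|` fset_set (norm_ball n)|)%:R)%R.

End Norm.

Definition cosets (G : groupType) (A N : set G) : set (set G) :=
  [set [set x * y | y in N] | x in A].

Definition polycyclic_series (G : groupType) (n : nat) (H : nat -> set G) :=
  [/\ H 0%N = setT, H n = [set 1], forall i, (i <= n)%N -> is_subgroup (H i)
    & forall i, (i < n)%N ->
      [/\ H i.+1 `<=` H i,
          forall x y, H i.+1 x -> H i y -> H i.+1 (x ^ y)
        & exists2 g, H i g & cosets (H i) (H i.+1) =
                             cosets (range (expgz g)) (H i.+1)]].

(* 0 if G has no polycyclic series *)
Definition hirsch_length (G : groupType) : nat :=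
  xget 0%N [set h | exists n (H : nat -> set G), polycyclic_series n H /\
    h = #|[pred i : 'I_n | `[< infinite_set (cosets (H i) (H i.+1)) >]]|].

Definition abelianization (G : groupType) : groupType :=
  quotient (gammaN G 2).

Definition zeta (R : realType) (s : nat) : R :=
  limn (series (fun n : nat => (n.+1%:R ^- s)%R : R)).

(* Main.v *)
(* Let g be the greatest common divisor of the exponents of the variables in the
   normal form of u. If u = 1 is solvable, then reducing modulo [G, G] shows
   that g divides the exponent of each element of infinite order of d_1.
   Conversely, let g > 0 and suppose that a substitution sends u into G_i. Its
   value is an element of G_i / G_(i+1) that is shifted by the exponents of d_i;
   as soon as these lie in a suitable residue class modulo g at the elements of
   infinite order, and take one suitable value at each of the others, the value
   is a g-th power. Multiplying the values of the variables by elements of G_i,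
   with Bezout coefficients, then sends u into G_(i+1). The class depends only on
   the preceding exponents, so its density does not.

   It remains to find the density of the k-tuples with greatest common divisor
   g. If P(N) is the proportion of primitive tuples in [-N, N]^k, then
   sum_g P(N / g) g^-k tends to 1. Since zeta(k) - 1 <= 3/4, this determines the
   limit of P by contraction, and it is 1 / zeta(k). *)

From HB Require Import structures.
Require Import Defs.
From mathcomp Require Import all_boot all_order all_algebra finmap.
From mathcomp Require Import all_classical all_reals all_analysis.
From mathcomp Require Import zify ring lra.
Set Implicit Arguments.
Unset Strict Implicit.
Unset Printing Implicit Defensive.
Import Order.TTheory GRing.Theory Num.Theory.
Import numFieldNormedType.Exports.

Local Open Scope classical_set_scope.
Local Open Scope ring_scope.

(** * Integer boxes and greatest common divisors *)

(** One greatest common divisor serves at every level: moving the variables by elements of G_i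
    changes the value of u modulo G_(i+1) by a homomorphism killing constants and commutators, so
    this change sees only the exponents of the variables. The elements of b_i with i > 1 are
    products of commutators; they affect the value to be corrected but not the possible corrections,
    so their exponents are fixed before those of d_i. An element of finite order w keeps one
    exponent out of w, whence 1/t(G), and each of the h(G) elements of infinite order keeps a
    proportion 1/g. The upper bound constrains only the m elements of infinite order in d_1.

    The sum over g grows with n, so limits are not taken term by term: it is cut at a fixed D, using
    terms of one sign, and D tends to infinity last.

    The contraction replaces Moebius inversion: the term g = 1 is isolated, and the others carry
    total weight zeta(k) - 1 < 1.

    Frequencies become proportions in boxes of exponents once normal forms are known to exist and be
    unique. As [hirsch_length] selects the count of some polycyclic series, its independence of the
    series is proved before it is computed from the base. *)

Definition exp_range (w n : nat) : seq int :=
  if w == 0%N then [seq i%:Z - n%:Z | i <- iota 0 n.*2.+1]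
  else [seq i%:Z | i <- iota 0 (minn n.+1 w)].

Lemma mem_exp_range w n a :
  (a \in exp_range w n) = in_Zomega w a && (`|a| <= n)%N.
Proof.
rewrite /exp_range /in_Zomega; case: eqP => [->|w0]; rewrite ?orTb ?orFb ?andTb.
  apply/mapP/idP => [[i]|an]; first by rewrite mem_iota => ? ->; lia.
  by exists (absz (a + n%:Z)); [rewrite mem_iota; lia|lia].
apply/mapP/idP => [[i]|an]; first by rewrite mem_iota => ? ->; lia.
by exists `|a|%N; [rewrite mem_iota; lia|lia].
Qed.

Lemma exp_range_uniq w n : uniq (exp_range w n).
Proof.
by rewrite /exp_range; case: eqP => _; rewrite map_inj_uniq ?iota_uniq// => i j;
  lia.
Qed.

Lemma size_exp_range0 n : size (exp_range 0 n) = n.*2.+1.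
Proof.
by rewrite size_map size_iota.
Qed.

Lemma size_exp_range w n : (0 < w <= n.+1)%N -> size (exp_range w n) = w.
Proof.
by rewrite /exp_range; case: eqP => [->//|_] /andP[_ wn]; rewrite size_map size_iota; lia.
Qed.

Lemma size_exp_range_gt0 w n : (0 < size (exp_range w n))%N.
Proof.
by rewrite /exp_range; case: eqP => w0; rewrite size_map size_iota//; lia.
Qed.

Fixpoint box (ws : seq nat) (n : nat) : seq (seq int) :=
  if ws is w :: ws' then [seq a :: z | a <- exp_range w n, z <- box ws' n]
  else [:: [::]].

Lemma box_uniq ws n : uniq (box ws n).
Proof.
elim: ws => //= w ws IH; apply: allpairs_uniq => //; first exact: exp_range_uniq.
by move=> [a z] [a' z'] _ _ /= [-> ->].
Qed.

Lemma mem_box ws n z : (z \in box ws n) =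
  [&& size z == size ws, all (fun p => in_Zomega p.1 p.2) (zip ws z)
    & all (fun a : int => `|a| <= n)%N z].
Proof.
elim: ws z => [|w ws IH] [|a z] //=.
- by apply/allpairsP => -[[? ?]] [].
- apply/allpairsP/idP => [[[a' z']] /= []|].
    rewrite mem_exp_range IH => /andP[wa an] /and3P[s ws' zn] [-> ->].
    by rewrite wa an ws' zn !andbT.
  move=> /and3P[s /andP[wa ws'] /andP[an zn]]; exists (a, z) => /=; split=> //.
    by rewrite mem_exp_range wa an.
  by move: s; rewrite eqSS IH => ->; rewrite ws' zn.
Qed.

Lemma count_box_cons (P : pred (seq int)) w ws n :
  count P (box (w :: ws) n) =
  (\sum_(a <- exp_range w n) count (fun z => P (a :: z)) (box ws n))%N.
Proof.
rewrite /= count_flatten sumnE !big_map; apply: eq_bigr => a _.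
by rewrite count_map.
Qed.

Lemma count_box_cat (P : pred (seq int)) ws ws' n :
  count P (box (ws ++ ws') n) =
  (\sum_(z <- box ws n) count (fun z' => P (z ++ z')) (box ws' n))%N.
Proof.
elim: ws P => [|w ws IH] P; first by rewrite big_seq1.
rewrite [_ ++ _]/= count_box_cons /= big_flatten big_map.
by apply: eq_bigr => a _; rewrite IH big_map.
Qed.

Lemma size_box ws n : size (box ws n) = (\prod_(w <- ws) size (exp_range w n))%N.
Proof.
elim: ws => [|w ws IH]; first by rewrite big_nil.
by rewrite big_cons -IH /= size_allpairs.
Qed.

Lemma size_box0 k n : size (box (nseq k 0%N) n) = (n.*2.+1 ^ k)%N.
Proof.
by rewrite size_box big_nseq size_exp_range0; elim: k => //= k ->; rewrite expnS.
Qed.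

Definition gcds (z : seq int) : nat := foldr (fun a g => gcdn `|a| g) 0%N z.

Lemma gcds_dvd z (a : int) : a \in z -> (gcds z %| `|a|)%N.
Proof.
elim: z => //= b z IH; rewrite inE => /orP[/eqP->|/IH az]; first exact: dvdn_gcdl.
exact: dvdn_trans (dvdn_gcdr _ _) az.
Qed.

Lemma dvdn_gcds z g : (g %| gcds z)%N = all (fun a : int => g %| `|a|)%N z.
Proof.
by elim: z => [|a z IH] /=; rewrite ?dvdn0// dvdn_gcd IH.
Qed.

Lemma gcds_bezout z :
  exists2 m : seq int, size m = size z
    & \sum_(p <- zip z m) p.1 * p.2 = (gcds z)%:Z.
Proof.
elim: z => [|a z [m sm mE]]; first by exists [::]; rewrite // big_nil.
have [u [v uv]] := Bezoutz a (gcds z)%:Z.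
exists (u :: [seq v * x | x <- m]) => [|/=]; first by rewrite /= size_map sm.
rewrite big_cons /=.
have -> : \sum_(p <- zip z [seq v * x | x <- m]) p.1 * p.2 = v * (gcds z)%:Z.
  rewrite -mE mulr_sumr {mE}.
  elim: z m sm {uv} => [|b z IH] [|x m] //=; rewrite ?big_nil// => -[sm].
  by rewrite !big_cons /= IH//; ring.
by rewrite [a * u]mulrC uv /gcdz absz_nat.
Qed.

Lemma gcds_scale (g : nat) z : gcds [seq g%:Z * a | a <- z] = (g * gcds z)%N.
Proof.
by elim: z => [|a z IH] /=; rewrite ?muln0// IH abszM absz_nat muln_gcdr.
Qed.

Lemma mem_box0 k n z : (z \in box (nseq k 0%N) n) =
  (size z == k) && all (fun a : int => `|a| <= n)%N z.
Proof.
rewrite mem_box size_nseq; case: eqP => //= sz; rewrite andb_idl// => _.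
by elim: z k sz => [|a z IH] [|k] //= [sz]; apply: IH.
Qed.

Definition gcd_count (k n g : nat) : nat :=
  count (fun z => gcds z == g) (box (nseq k 0%N) n).

(** Multiplication by g is a bijection from the primitive tuples bounded by [n %/ g] to the tuples
    bounded by n with greatest common divisor g. *)
Lemma gcd_count_scale k n g : (0 < g)%N ->
  gcd_count k n g = gcd_count k (n %/ g) 1.
Proof.
move=> g0; rewrite /gcd_count -!size_filter.
rewrite -[RHS](size_map (fun z => [seq g%:Z * a | a <- z])); apply: perm_size.
have inj : injective (fun z => [seq g%:Z * a | a <- z]).
  by apply: inj_map => x y /(@mulfI _ g%:Z); apply; lia.
apply: uniq_perm; rewrite ?(map_inj_uniq inj) ?filter_uniq ?box_uniq// => z.
rewrite mem_filter mem_box0; apply/idP/mapP.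
  move=> /andP[/eqP gz /andP[sz zn]].
  have dz a : a \in z -> (g %| `|a|)%N by rewrite -gz; exact: gcds_dvd.
  have zE : z = [seq g%:Z * a | a <- [seq (a %/ g)%Z | a <- z]].
    rewrite -map_comp map_id_in // => a /dz ga /=.
    by rewrite mulrC divzK// /dvdz.
  exists [seq (a %/ g)%Z | a <- z] => //.
  rewrite mem_filter mem_box0 size_map sz all_map /=; apply/andP; split.
    have := gz; rewrite {1}zE gcds_scale -[X in _ = X]muln1 => /eqP.
    by rewrite eqn_pmul2l.
  apply/allP => a az; have /allP/(_ _ az) an := zn; rewrite /=.
  have /dvdnP[q aq] := dz _ az.
  have -> : `|(a %/ g)%Z|%N = q.
    apply/eqP; rewrite -(eqn_pmul2r g0) -aq -[X in (_ * X)%N]absz_nat -abszM.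
    by rewrite divzK ?aq// dvdzE dz.
  by rewrite leq_divRL// -aq.
move=> [y]; rewrite mem_filter mem_box0 => /andP[/eqP gy /andP[sy yn]] ->.
rewrite gcds_scale gy muln1 eqxx size_map sy all_map /=.
apply/allP => a ay /=; have /allP/(_ _ ay) := yn.
by rewrite leq_divRL// abszM absz_nat mulnC.
Qed.

Lemma gcds_le k n z : (0 < k)%N -> z \in box (nseq k 0%N) n -> (gcds z <= n)%N.
Proof.
move=> k0; rewrite mem_box0 => /andP[/eqP sz zn].
have [->//|z0] := eqVneq (gcds z) 0%N.
have [/allP z1|] := boolP (all (fun a : int => a == 0) z).
  suff: gcds z = 0%N by move/eqP: z0.
  by apply/eqP; rewrite -dvd0n dvdn_gcds; apply/allP => a /z1 /eqP ->.
case/allPn => a az a0; have /allP/(_ _ az) := zn; apply: leq_trans.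
by apply: dvdn_leq; [rewrite absz_gt0|exact: gcds_dvd].
Qed.

Lemma gcd_count0 k n : gcd_count k n 0 = 1%N.
Proof.
rewrite /gcd_count -size_filter.
suff /perm_size-> : perm_eq [seq z <- box (nseq k 0%N) n | gcds z == 0%N]
  [:: nseq k 0] by [].
apply: uniq_perm; rewrite ?filter_uniq ?box_uniq// => z.
rewrite mem_filter mem_box0 inE -dvd0n dvdn_gcds; apply/idP/eqP.
  move=> /and3P[/allP z0 /eqP <- _].
  elim: z z0 => //= a z IH z0; congr cons; last first.
    by apply: IH => b bz; apply: z0; rewrite inE bz orbT.
  by apply/eqP; rewrite -absz_eq0 -dvd0n z0// mem_head.
by move=> ->; rewrite size_nseq eqxx !all_nseq /= dvdnn !orbT.
Qed.

Lemma gcd_count_sum k n : (0 < k)%N ->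
  (\sum_(0 <= g < n.+1) gcd_count k n g = n.*2.+1 ^ k)%N.
Proof.
move=> k0; rewrite -size_box0 /gcd_count.
have : all (fun z => gcds z <= n)%N (box (nseq k 0%N) n).
  by apply/allP => z; exact: gcds_le.
elim: (box _ _) => [_|z s IH /= /andP[zn /IH {}IH]].
  by rewrite big1.
rewrite big_split /= IH -[RHS]add1n; congr addn.
rewrite (bigD1_seq (gcds z)) ?iota_uniq ?mem_index_iota//=.
by rewrite eqxx big1 ?addn0// => i; rewrite eq_sym => /negPf ->.
Qed.

Lemma sum_box_gcds k n (F : seq int -> nat) : (0 < k)%N ->
  (\sum_(z <- box (nseq k 0) n) F z =
   \sum_(0 <= g < n.+1) \sum_(z <- box (nseq k 0) n | gcds z == g) F z)%N.
Proof.
move=> k0; under [RHS]eq_bigr do rewrite big_mkcond.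
rewrite exchange_big big_seq [RHS]big_seq; apply: eq_bigr => z /(gcds_le k0) zn.
rewrite (bigD1_seq (gcds z)) ?iota_uniq ?mem_index_iota//= eqxx.
by rewrite big1 ?addn0// => g; rewrite eq_sym => /negPf ->.
Qed.

Lemma count_dvd_range n g : (0 < g)%N ->
  count (fun a : int => g %| `|a|)%N (exp_range 0 n) = (n %/ g).*2.+1.
Proof.
move=> g0; rewrite -size_filter -size_exp_range0.
rewrite -[RHS](size_map (fun a => g%:Z * a)); apply: perm_size.
apply: uniq_perm; rewrite ?filter_uniq ?exp_range_uniq//.
  by rewrite map_inj_uniq ?exp_range_uniq// => x y /(@mulfI _ g%:Z); apply; lia.
move=> a; rewrite mem_filter mem_exp_range andTb; apply/andP/mapP.
  move=> [/dvdnP[q aq] an]; exists (a %/ g)%Z; last first.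
    by rewrite mulrC divzK// dvdzE aq dvdn_mull.
  rewrite mem_exp_range /= leq_divRL// -[X in (_ * X)%N]absz_nat -abszM.
  by rewrite divzK// dvdzE aq dvdn_mull.
move=> [x]; rewrite mem_exp_range /= => xn ->.
by rewrite abszM absz_nat dvdn_mulr//; move: xn; rewrite leq_divRL// mulnC.
Qed.

(** Each block of g consecutive integers meets the class of r; the remainder of [r - a] modulo g is
    the offset of the meeting point in the first block. *)
Lemma count_congr_iota (g q a : nat) (r : int) : (0 < g)%N ->
  (q <= count (fun i : nat => (g %| (i%:Z - r)%R)%Z) (iota a (q * g)))%N.
Proof.
move=> g0; elim: q a => [//|q IH] a.
rewrite mulSn iotaD count_cat -add1n leq_add// -has_count; apply/hasP.
have g0' : g%:Z != 0 by lia.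
have := modz_ge0 (r - a%:Z) g0'; have := ltz_pmod (r - a%:Z) (d := g%:Z).
set m := modz _ _ => /(_ ltac:(lia)) mg m0.
exists (a + `|m|)%N; first by rewrite mem_iota; lia.
rewrite PoszD gez0_abs//.
have -> : a%:Z + m - r = - (divz (r - a%:Z) g%:Z * g%:Z).
  by have := divz_eq (r - a%:Z) g%:Z; rewrite -/m; lia.
by rewrite dvdzE abszN abszM dvdn_mull.
Qed.

(** Only complete blocks of length g are counted, whence the rounding down; the leftover of the
    interval may or may not meet the class. *)
Lemma count_congr_range n g (r : int) : (0 < g)%N ->
  (n.*2.+1 %/ g <= count (fun a : int => (g %| (a - r)%R)%Z) (exp_range 0 n))%N.
Proof.
move=> g0; rewrite /exp_range eqxx count_map.
rewrite (divn_eq n.*2.+1 g) iotaD count_cat (divn_eq n.*2.+1 g).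
rewrite divnMDl// (divn_small (ltn_pmod _ g0)) addn0.
apply: leq_trans (leq_addr _ _).
apply: leq_trans (count_congr_iota _ 0 (r + n%:Z) g0) _.
by apply/eq_leq/eq_count => i /=; congr (_ %| _)%Z; lia.
Qed.

Lemma gcds_factor z :
  exists2 z' : seq int, size z' = size z & z = [seq (gcds z)%:Z * a | a <- z'].
Proof.
exists [seq (a %/ gcds z)%Z | a <- z]; first by rewrite size_map.
rewrite -map_comp map_id_in // => a az /=.
by rewrite mulrC divzK// dvdzE; exact: gcds_dvd.
Qed.

Lemma count_box_prod (T : Type) (w : T -> nat) (P : T -> pred int) (s : seq T) n :
  count (fun z => all (fun q => P q.1 q.2) (zip s z)) (box [seq w x | x <- s] n) =
  (\prod_(x <- s) count (P x) (exp_range (w x) n))%N.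
Proof.
elim: s => [|x s IH]; first by rewrite big_nil.
rewrite big_cons [map _ _]/= count_box_cons -IH /=.
elim: (exp_range _ _) => [|a r IHr]; first by rewrite big_nil.
rewrite big_cons /= IHr mulnDl; congr addn; case: (P x a); first by rewrite mul1n.
by rewrite mul0n; apply/eqP; rewrite -leqn0 leqNgt -has_count -all_predC all_predT.
Qed.

(** * Densities of greatest common divisors *)

Section Density.
Variable R : realType.

Lemma cvg_sum_nat (f : nat -> nat -> R) (l : nat -> R) m n :
  (forall i, f i @ \oo --> l i) ->
  (fun x => \sum_(m <= i < n) f i x) @ \oo --> \sum_(m <= i < n) l i.
Proof.
by move=> fl; apply: cvg_big => [|i _]; [exact: add_continuous|exact: fl].
Qed.

Lemma cvg_exprn (f : nat -> R) (l : R) n :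
  f @ \oo --> l -> (fun x => f x ^+ n) @ \oo --> l ^+ n.
Proof. exact: continuous_cvg (@exprn_continuous R n l). Qed.

Implicit Types (u v : nat -> R) (k n g : nat).

Lemma bounded_fun01 (u : R^o^nat) : (forall n, 0 <= u n <= 1) -> bounded_fun u.
Proof.
move=> u01; exists 1; split; first exact: num_real.
move=> M M1 n _ /=; have /andP[u0 u1] := u01 n.
by rewrite ger0_norm// (le_trans u1)// ltW.
Qed.

(** The bounds 0 and 1 make the sequence of suprema of tails converge, so that [limn_sup] is a
    genuine limit. *)
Lemma limn_sup_le (u : R^o^nat) v l : (forall n, 0 <= u n <= 1) ->
  (\forall n \near \oo, u n <= v n) -> v @ \oo --> l -> limn_sup u <= l.
Proof.
move=> u01 uv vl; have bu := bounded_fun01 u01.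
apply/ler_addgt0Pr => e e0; apply: limr_le.
  apply: nonincreasing_is_cvgn; last exact: bounded_fun_has_lbound_sups.
  exact/nonincreasing_sups/bounded_fun_has_ubound.
have /cvgrPdist_le/(_ _ e0) vle := vl.
have [N _ NP] : \forall n \near \oo, u n <= l + e.
  near=> n; have : u n <= v n by near: n.
  have : `|l - v n| <= e by near: n.
  by rewrite ler_norml; lra.
exists N => // n /= Nn; apply: ge_sup; first by exists (u n) => /=; exists n => /=.
by move=> _ [m /= nm <-]; apply: NP; exact: leq_trans nm.
Unshelve. all: by end_near. Qed.

Lemma limn_inf_ge (u : R^o^nat) v l : (forall n, 0 <= u n <= 1) ->
  (\forall n \near \oo, v n <= u n) -> v @ \oo --> l -> l <= limn_inf u.
Proof.
move=> u01 uv vl; have bu := bounded_fun01 u01.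
apply/ler_addgt0Pr => e e0; rewrite -lerBlDr; apply: limr_ge.
  apply: nondecreasing_is_cvgn; last exact: bounded_fun_has_ubound_infs.
  exact/nondecreasing_infs/bounded_fun_has_lbound.
have /cvgrPdist_le/(_ _ e0) vle := vl.
have [N _ NP] : \forall n \near \oo, l - e <= u n.
  near=> n; have : v n <= u n by near: n.
  have : `|l - v n| <= e by near: n.
  by rewrite ler_norml; lra.
exists N => // n /= Nn; apply: lb_le_inf; first by exists (u n) => /=; exists n => /=.
by move=> _ [m /= nm <-]; apply: NP; exact: leq_trans nm.
Unshelve. all: by end_near. Qed.

(** * Partial sums and tails of the zeta series *)

Definition zeta_sum k n : R := \sum_(0 <= i < n) i.+1%:R ^- k.

Lemma zeta_term_le k n : (1 < k)%N -> n.+2%:R ^- k <= n.+1%:R^-1 - n.+2%:R^-1 :> R.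
Proof.
move=> k2; apply: (@le_trans _ _ (n.+2%:R ^- 2)).
  by rewrite lef_pV2 ?posrE ?exprn_gt0 ?ltr0n//; apply: ler_weXn2l; rewrite ?ler1n.
have n1 : (0 : R) < n.+1%:R by rewrite ltr0n.
have n2 : n.+2%:R = n.+1%:R + 1 :> R by rewrite -natr1.
have -> : n.+1%:R^-1 - n.+2%:R^-1 = n.+1%:R^-1 * n.+2%:R^-1 :> R.
  by rewrite n2; move: (n.+1%:R) n1 => x x0; field; rewrite !gt_eqF//; lra.
rewrite expr2 invfM ler_wpM2r ?invr_ge0 ?ler0n//.
by rewrite lef_pV2 ?posrE ?ltr0n// ler_nat.
Qed.

(** The terms are dominated by the telescoping differences 1/i - 1/(i+1). *)
Lemma zeta_tail_le k n m : (1 < k)%N -> (0 < n)%N ->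
  \sum_(n <= i < m) i.+1%:R ^- k <= n%:R^-1 :> R.
Proof.
move=> k2; case: n => // n _; have [mn|nm] := leqP m n.+1.
  by rewrite big_geq// invr_ge0 ler0n.
apply: (@le_trans _ _ (n.+1%:R^-1 - m%:R^-1)); last first.
  by rewrite gerBl invr_ge0 ler0n.
have := @telescope_sumr _ n.+1 m (fun i => - (i%:R : R)^-1) (ltnW nm).
rewrite opprK [- _ + _]addrC => <-; rewrite big_seq [leRHS]big_seq; apply: ler_sum => -[|i].
  by rewrite mem_index_iota.
by move=> _; rewrite opprK addrC; exact: zeta_term_le.
Qed.

Lemma zeta_sum_nd k : nondecreasing_seq (zeta_sum k).
Proof.
by apply: nondecreasing_series => i _ _; rewrite invr_ge0 exprn_ge0.
Qed.

Lemma zeta_sum_le k n m : (1 < k)%N -> (0 < n)%N ->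
  zeta_sum k m <= zeta_sum k n + n%:R^-1.
Proof.
move=> k2 n0; have [mn|/ltnW nm] := leqP m n.
  rewrite (le_trans (zeta_sum_nd k mn))// lerDl invr_ge0 ler0n//.
rewrite /zeta_sum (@big_cat_nat _ _ _ n 0 m)//=.
by rewrite lerD2l zeta_tail_le.
Qed.

Lemma zeta_cvg k : (1 < k)%N -> zeta_sum k @ \oo --> zeta R k.
Proof.
move=> k2; apply: (nondecreasing_is_cvgn (zeta_sum_nd k)).
by exists (zeta_sum k 1 + 1%:R^-1) => _ [n _ <-]; exact: zeta_sum_le.
Qed.

Lemma zeta_sum_le_zeta k n : (1 < k)%N -> zeta_sum k n <= zeta R k.
Proof.
move=> k2; apply: (nondecreasing_cvgn_le (zeta_sum_nd k)).
by apply/cvg_ex; exists (zeta R k); exact: zeta_cvg.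
Qed.

Lemma zeta_le_zeta_sum k n : (1 < k)%N -> (0 < n)%N ->
  zeta R k <= zeta_sum k n + n%:R^-1.
Proof.
move=> k2 n0; rewrite -(cvg_lim _ (zeta_cvg k2))//; apply: limr_le.
  by apply/cvg_ex; exists (zeta R k); exact: zeta_cvg.
by apply: nearW => m; exact: zeta_sum_le.
Qed.

Lemma zeta_ge1 k : (1 < k)%N -> 1 <= zeta R k.
Proof.
move=> k2; apply: le_trans (zeta_sum_le_zeta 1 k2).
by rewrite /zeta_sum big_nat1 expr1n invr1.
Qed.

(** 7/4 is 1 + 1/4, a bound on the first two terms, plus 1/2 for the tail. The contraction needs a
    bound below 2. *)
Lemma zeta_le k : (1 < k)%N -> zeta R k <= 7 / 4.
Proof.
move=> k2; apply: le_trans (zeta_le_zeta_sum (n := 2) k2 _) _ => //.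
rewrite /zeta_sum big_nat_recr//= big_nat1 expr1n invr1.
have : (2%:R : R) ^- k <= 2%:R ^- 2.
  by rewrite lef_pV2 ?posrE ?exprn_gt0 ?ltr0n// ler_eXn2l// ltr1n.
rewrite expr2; lra.
Qed.

(** * Limit frequencies of multiples and of greatest common divisors *)

Local Notation side n := (n.*2.+1%:R : R).

Lemma side_gt0 n : 0 < side n. Proof. by rewrite ltr0n. Qed.

Lemma side_inv_cvg : (fun n => (side n)^-1) @ \oo --> (0 : R).
Proof.
apply: (@squeeze_cvgr _ _ _ _ (fun=> 0) (@harmonic R)); last 2 first.
- exact: cvg_cst.
- exact: cvg_harmonic.
near=> n; rewrite invr_ge0 ler0n /= lef_pV2 ?posrE ?ltr0n// ler_nat; lia.
Unshelve. all: by end_near. Qed.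

(** The hypothesis says that [w n * g] differs from the length of the interval by at most one
    period. It covers both the count of multiples of g and the rounded count of a residue class. *)
Lemma ratio_cvg (w : nat -> nat) g : (0 < g)%N ->
  (forall n, (n.*2.+1 <= w n * g + g)%N /\ (w n * g <= n.*2.+1 + g)%N) ->
  (fun n => (w n)%:R / side n) @ \oo --> (g%:R^-1 : R).
Proof.
move=> g0 wg; have gR : (0 : R) < g%:R by rewrite ltr0n.
apply: (@squeeze_cvgr _ _ _ _ (fun n => g%:R^-1 - (side n)^-1)
   (fun n => g%:R^-1 + (side n)^-1)).
- near=> n; have [] := wg n.
  rewrite -(ler_nat R) -[(_ * g <= _)%N](ler_nat R) !natrD natrM => h1 h2.
  have s0 := side_gt0 n; have si : side n * (side n)^-1 = 1 by rewrite divff ?gt_eqF.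
  have gi : g%:R * g%:R^-1 = 1 :> R by rewrite divff ?gt_eqF.
  rewrite -(ler_pM2r s0) -(ler_pM2r gR) -[X in _ && X](ler_pM2r s0).
  rewrite -[X in _ && X](ler_pM2r gR).
  have -> : (g%:R^-1 - (side n)^-1) * side n * g%:R = side n - g%:R.
    by field; rewrite !gt_eqF.
  have -> : (g%:R^-1 + (side n)^-1) * side n * g%:R = side n + g%:R.
    by field; rewrite !gt_eqF.
  have -> : (w n)%:R / side n * side n * g%:R = (w n)%:R * g%:R.
    by field; rewrite !gt_eqF.
  by apply/andP; split; lra.
- rewrite -[X in _ --> X]subr0; apply: cvgB; first exact: cvg_cst.
  exact: side_inv_cvg.
- rewrite -[X in _ --> X]addr0; apply: cvgD; first exact: cvg_cst.
  exact: side_inv_cvg.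
Unshelve. all: by end_near. Qed.

(* The proportion of [-n, n] occupied by the multiples of g. *)
Definition multiples n g : R := (n %/ g).*2.+1%:R / side n.

Lemma multiples_cvg g : (0 < g)%N -> (multiples ^~ g) @ \oo --> (g%:R^-1 : R).
Proof.
move=> g0; apply: ratio_cvg => // n.
have := divn_eq n g; have := ltn_pmod n g0; lia.
Qed.

Lemma multiples_ge0 n g : 0 <= multiples n g.
Proof. by rewrite divr_ge0 ?ler0n. Qed.

Lemma multiples_le1 n g : multiples n g <= 1.
Proof.
rewrite ler_pdivrMr ?ltr0n// mul1r ler_nat ltnS leq_double.
exact: leq_div.
Qed.

(** A bound that is uniform in n and summable over g, to control the tail of the sum over g. For g
    <= n the proportion of multiples is at most 3/(2g), and 9/4 <= 3. *)
Lemma multiples_exp_le k n g : (1 < k)%N -> (0 < g <= n)%N ->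
  multiples n g ^+ k <= 3 * g%:R ^- 2.
Proof.
move=> k2 /andP[g0 gn].
apply: (@le_trans _ _ (multiples n g ^+ 2)).
  by rewrite ler_wiXn2l ?multiples_ge0 ?multiples_le1.
have gR : (0 : R) < g%:R by rewrite ltr0n.
apply: (@le_trans _ _ ((3 / 2 * g%:R^-1) ^+ 2)); last first.
  rewrite exprMn exprVn ler_wpM2r ?invr_ge0 ?exprn_ge0//; lra.
apply: lerXn2r; rewrite ?nnegrE ?multiples_ge0//.
rewrite /multiples. rewrite ler_pdivrMr ?side_gt0//.
have -> : 3 / 2 / g%:R * side n = (3 * side n) / (2 * g%:R) by field; rewrite gt_eqF.
rewrite ler_pdivlMr ?mulr_gt0// -!natrM ler_nat.
have := leq_divM n g; lia.
Qed.

Definition gcd_freq k n g : R := (gcd_count k n g)%:R / side n ^+ k.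

Lemma gcd_freq_ge0 k n g : 0 <= gcd_freq k n g.
Proof. by rewrite divr_ge0 ?exprn_ge0 ?ler0n. Qed.

Lemma gcd_freqE k n g : (0 < g)%N ->
  gcd_freq k n g = gcd_freq k (n %/ g) 1 * multiples n g ^+ k.
Proof.
move=> g0; rewrite /gcd_freq gcd_count_scale// /multiples expr_div_n.
by field; rewrite !expf_neq0 ?pnatr_eq0.
Qed.

Lemma gcd_freq_sum k n : (0 < k)%N ->
  gcd_freq k n 0 + \sum_(0 <= i < n) gcd_freq k n i.+1 = 1.
Proof.
move=> k0; rewrite /gcd_freq -mulr_suml -mulrDl.
have /(congr1 (fun i => i%:R : R)) := gcd_count_sum n k0.
rewrite natr_sum big_nat_recl// natrX => ->.
by rewrite divff// expf_neq0 ?pnatr_eq0.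
Qed.

Lemma gcd_freq_le1 k n g : (0 < k)%N -> gcd_freq k n g <= 1.
Proof.
move=> k0; rewrite ler_pdivrMr ?exprn_gt0 ?ltr0n// mul1r -natrX ler_nat.
by rewrite -size_box0 count_size.
Qed.

(* The identity [gcd_freq_sum] bounds the distance of [gcd_freq k n 1] to the
   inverse of zeta by [zeta k - 1 <= 3/4] times the same distance at the
   smaller arguments [n %/ g], up to small terms. *)
Lemma gcd_freq1_dist k n D (E : R) : (1 < k)%N -> (1 < D <= n)%N ->
  (forall i, (i < D)%N ->
     `|gcd_freq k (n %/ i.+1) 1 - (zeta R k)^-1| <= E) ->
  `|gcd_freq k n 1 - (zeta R k)^-1| <= 3 / 4 * E + 4 / D%:R + (side n)^-1 +
    \sum_(1 <= i < D) `|i.+1%:R ^- k - multiples n i.+1 ^+ k|.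
Proof.
move=> k2 /andP[D2 Dn] aE; set a := (zeta R k)^-1; set Z := zeta R k.
have k0 : (0 < k)%N by apply: ltnW.
have Z1 : 1 <= Z by exact: zeta_ge1.
have Z0 : Z != 0 by rewrite gt_eqF// (lt_le_trans _ Z1).
have a0 : 0 <= a by rewrite invr_ge0 (le_trans _ Z1).
have a1 : a <= 1 by rewrite invf_le1 ?(lt_le_trans _ Z1).
have E0 : 0 <= E by apply: le_trans (aE 0%N _) => //; exact: ltnW.
have D0 : (0 : R) < D%:R by rewrite ltr0n ltnW.
pose f i := gcd_freq k n i.+1.
have split_sum : \sum_(0 <= i < n) f i =
    f 0%N + \sum_(1 <= i < D) f i + \sum_(D <= i < n) f i.
  rewrite big_ltn; last by apply: leq_trans Dn; exact: ltnW.
  by rewrite (@big_cat_nat _ _ _ D 1 n)//= ?addrA// ltnW.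
have := gcd_freq_sum n k0; rewrite split_sum => fE.
have q0 : 0 <= gcd_freq k n 0 <= (side n)^-1.
  rewrite gcd_freq_ge0 /gcd_freq gcd_count0 mul1r lef_pV2 ?posrE ?exprn_gt0 ?ltr0n//.
  by rewrite -[leLHS]expr1; apply: ler_weXn2l; rewrite ?ler1n.
have tail : 0 <= \sum_(D <= i < n) f i <= 3 / D%:R.
  rewrite sumr_ge0 => [|i _]; last exact: gcd_freq_ge0.
  apply: (@le_trans _ _ (\sum_(D <= i < n) 3 * i.+1%:R ^- 2)).
    rewrite big_nat [leRHS]big_nat; apply: ler_sum => i /andP[Di iN].
    rewrite /f gcd_freqE//; apply: le_trans (@multiples_exp_le k n i.+1 k2 iN).
    by rewrite ler_piMl ?exprn_ge0 ?multiples_ge0// gcd_freq_le1.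
  by rewrite -mulr_sumr ler_wpM2l// zeta_tail_le// ltnW.
have zD : zeta_sum k D = 1 + \sum_(1 <= i < D) i.+1%:R ^- k.
  by rewrite /zeta_sum big_ltn ?(ltnW D2)// expr1n invr1.
have zt : 0 <= Z - zeta_sum k D <= D%:R^-1.
  rewrite subr_ge0 zeta_sum_le_zeta//= lerBlDl zeta_le_zeta_sum//; exact: ltnW.
have mid : `|\sum_(1 <= i < D) (a * i.+1%:R ^- k - f i)| <=
    3 / 4 * E + \sum_(1 <= i < D) `|i.+1%:R ^- k - multiples n i.+1 ^+ k|.
  apply: (@le_trans _ _ (\sum_(1 <= i < D) (i.+1%:R ^- k * E +
      `|i.+1%:R ^- k - multiples n i.+1 ^+ k|))).
    rewrite (le_trans (ler_norm_sum _ _ _))// big_nat [leRHS]big_nat.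
    apply: ler_sum => i /andP[_ iD].
    rewrite /f gcd_freqE//; set b := gcd_freq _ _ _; set m := multiples _ _ ^+ k.
    have b01 : 0 <= b <= 1 by rewrite gcd_freq_ge0 gcd_freq_le1.
    (* This separates the error of the primitive frequency at [n %/ i.+1], weighted by the term of
       zeta, from the error in the density of multiples. *)
    have -> : a * i.+1%:R ^- k - b * m =
      i.+1%:R ^- k * (a - b) + b * (i.+1%:R ^- k - m) by ring.
    rewrite (le_trans (ler_normD _ _))// lerD//.
      rewrite normrM ger0_norm ?invr_ge0 ?exprn_ge0//.
      by rewrite ler_wpM2l ?invr_ge0 ?exprn_ge0// distrC aE.
    by rewrite normrM ger0_norm ?(andP b01).1// ler_piMl// (andP b01).2.
  rewrite big_split /= lerD2r -mulr_suml ler_wpM2r//.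
  have : zeta_sum k D <= Z by exact: zeta_sum_le_zeta.
  have : Z <= 7 / 4 by exact: zeta_le.
  by rewrite zD; lra.
have aZ : a * Z = 1 by rewrite mulVf.
(* Subtract the identity [fE], where the frequencies sum to 1, from [aZ], where 1 is [a] times zeta;
   both sums are cut at D. *)
have -> : gcd_freq k n 1 - a = a * (Z - zeta_sum k D) - gcd_freq k n 0 +
    \sum_(1 <= i < D) (a * i.+1%:R ^- k - f i) - \sum_(D <= i < n) f i.
  rewrite sumrB -mulr_sumr zD; move: fE; rewrite -[gcd_freq k n 1]/(f 0%N).
  move=> fE.
  have -> : f 0%N = 1 - gcd_freq k n 0 - \sum_(1 <= i < D) f i
     - \sum_(D <= i < n) f i by rewrite -fE; ring.
  by rewrite mulrBr aZ; ring.
have az : 0 <= a * (Z - zeta_sum k D) <= D%:R^-1.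
  rewrite mulr_ge0 ?(andP zt).1//=; apply: le_trans (andP zt).2.
  by rewrite ler_piMl// (andP zt).1.
move: mid q0 tail az; rewrite !ler_norml.
set x := \sum_(1 <= i < D) (_ - _); set y := \sum_(1 <= i < D) `|_|.
(* 3/D bounds the tail of the frequencies and 1/D the tail of zeta. *)
have -> : 4 / D%:R = 3 / D%:R + D%:R^-1 :> R by field; rewrite gt_eqF.
move: x y (gcd_freq k n 0) (side n)^-1 (D%:R^-1) (\sum_(D <= i < n) f i) => x y p q r t.
by move: (a * _) => w; lra.
Qed.

Lemma multiples_dist_cvg k D :
  (fun n => \sum_(1 <= i < D) `|i.+1%:R ^- k - multiples n i.+1 ^+ k|)
    @ \oo --> (0 : R).
Proof.
have {2}<- : \sum_(1 <= i < D) `|i.+1%:R ^- k - i.+1%:R^-1 ^+ k| = 0 :> R.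
  by rewrite big1// => i _; rewrite exprVn subrr normr0.
apply: (@cvg_sum_nat (fun i n => `|i.+1%:R ^- k - multiples n i.+1 ^+ k|)) => i.
apply: cvg_norm; apply: cvgB; first exact: cvg_cst.
by apply: cvg_exprn; exact: multiples_cvg.
Qed.

Lemma gcd_freq1_contract k (E : R) : (1 < k)%N -> 0 < E ->
  (\forall n \near \oo, `|gcd_freq k n 1 - (zeta R k)^-1| <= E) ->
  \forall n \near \oo, `|gcd_freq k n 1 - (zeta R k)^-1| <= 7 / 8 * E.
Proof.
move=> k2 E0 [N _ NE].
(* With 96/E < D, the term 4/D is at most E/24. Three errors of size E/24 add E/8 to 3E/4, which
   gives the factor 7/8; the [.+2] also ensures D > 1. *)
pose D := (Num.truncn (96 / E)).+2.
have DE : 4 / D%:R <= E / 24.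
  have DE : 96 / E < D%:R.
    by rewrite (lt_trans (truncnS_gt _))// ltr_nat; exact: ltnSn.
  have D0 : (0 : R) < D%:R by rewrite ltr0n.
  rewrite ler_pdivrMr//; move: DE; rewrite ltr_pdivrMr//; lra.
have E24 : 0 < E / 24 by lra.
have /cvgrPdist_le/(_ _ E24) sE := side_inv_cvg.
have /cvgrPdist_le/(_ _ E24) mE := @multiples_dist_cvg k D.
near=> n.
apply: le_trans (gcd_freq1_dist (D := D) (E := E) k2 _ _) _ => [|i iD|].
- by near: n; exists D => // m /=; rewrite /D.
- apply: NE => /=; rewrite leq_divRL//; apply: (@leq_trans (N * D)%N).
    by rewrite leq_mul2l iD orbT.
  by near: n; exists (N * D)%N.
- have : `|0 - (side n)^-1| <= E / 24 by near: n.
  have : `|0 - \sum_(1 <= i < D) `|i.+1%:R ^- k - multiples n i.+1 ^+ k| |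
     <= E / 24 by near: n.
  rewrite !sub0r !normrN => /(le_trans (ler_norm _)) h1 /(le_trans (ler_norm _)) h2.
  move: h1 h2 DE; set y := \sum_(_ <= _ < _) _; move: y (side n)^-1 (4 / _) => x y z; lra.
Unshelve. all: by end_near. Qed.

Lemma gcd_freq1_cvg k : (1 < k)%N ->
  (fun n => gcd_freq k n 1) @ \oo --> (zeta R k)^-1.
Proof.
move=> k2; have k0 : (0 < k)%N by apply: ltnW.
have H j : \forall n \near \oo,
    `|gcd_freq k n 1 - (zeta R k)^-1| <= (7 / 8) ^+ j.
  elim: j => [|j IH]; last first.
    by rewrite exprS; apply: gcd_freq1_contract => //; rewrite exprn_gt0//; lra.
  (* The iteration starts from distance 1, as both numbers lie in [0, 1]. *)
  apply: nearW => n; rewrite expr0 ler_norml.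
  have := gcd_freq_ge0 k n 1; have := gcd_freq_le1 n 1 k0.
  have Z1 := zeta_ge1 k2; have Z0 := lt_le_trans ltr01 Z1.
  have : 0 <= (zeta R k)^-1 <= 1 by rewrite invr_ge0 ltW//= invf_le1.
  lra.
apply/cvgrPdist_le => e e0.
have /cvgrPdist_le/(_ _ e0)[j _ /(_ j (leqnn j))] :
    (fun j => (7 / 8 : R) ^+ j) @ \oo --> (0 : R).
  by apply: cvg_expr; rewrite ger0_norm; lra.
rewrite sub0r normrN => /(le_trans (ler_norm _)) je.
by apply: filterS (H j) => n; rewrite distrC => /le_trans; apply.
Qed.

Lemma gcd_freq_cvg k g : (1 < k)%N -> (0 < g)%N ->
  (fun n => gcd_freq k n g) @ \oo --> (zeta R k)^-1 * g%:R ^- k.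
Proof.
move=> k2 g0; under eq_fun do rewrite gcd_freqE//.
apply: cvgM; last by rewrite -exprVn; apply: cvg_exprn; exact: multiples_cvg.
apply: (cvg_comp (fun n => n %/ g)%N (fun n => gcd_freq k n 1)) (gcd_freq1_cvg k2).
move=> A [N _ NA]; exists (N * g)%N => // n /= Nn; apply: NA => /=.
by rewrite leq_divRL.
Qed.

Lemma exprB_natV k m i : (i.+1%:R : R) ^- k * i.+1%:R^-1 ^+ m = i.+1%:R ^- (k + m).
Proof. by rewrite exprVn -invfM -exprD addnC. Qed.

(** Since all frequencies sum to 1, the bound equals 1 plus a sum of terms
    [gcd_freq * (multiples ^+ m - 1)], none of which is positive. Dropping those beyond D can only
    increase it, and the term of the zero tuple is absorbed in the 1. *)
Lemma limn_sup_gcd_freq k m (u : R^o^nat) : (1 < k)%N ->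
  (forall n, 0 <= u n <= 1) ->
  (forall n, u n <= gcd_freq k n 0 +
     \sum_(0 <= i < n) gcd_freq k n i.+1 * multiples n i.+1 ^+ m) ->
  limn_sup u <= zeta R (k + m) / zeta R k.
Proof.
move=> k2 u01 uE; have k0 : (0 < k)%N by apply: ltnW.
have km2 : (1 < k + m)%N by apply: leq_trans k2 _; exact: leq_addr.
have Z0 : zeta R k != 0 by rewrite gt_eqF// (lt_le_trans _ (zeta_ge1 k2)).
have H D : limn_sup u <=
    1 + (zeta R k)^-1 * (zeta_sum (k + m) D - zeta_sum k D).
  apply: (@limn_sup_le _ (fun n => 1 + \sum_(0 <= i < D)
     gcd_freq k n i.+1 * (multiples n i.+1 ^+ m - 1))) => //.
    near=> n; have Dn : (D <= n)%N by near: n; exists D.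
    apply: le_trans (uE n) _; rewrite -[X in _ <= X + _](gcd_freq_sum n k0).
    rewrite -addrA lerD2l !(@big_cat_nat _ _ _ D 0 n)//= addrAC lerD//.
      rewrite -big_split /= le_eqVlt; apply/orP; left; apply/eqP.
      by apply: eq_bigr => i _; ring.
    apply: ler_sum => i _; rewrite ler_piMr ?gcd_freq_ge0//.
    by rewrite exprn_ile1 ?multiples_ge0 ?multiples_le1.
  apply: cvgD; first exact: cvg_cst.
  have -> : (zeta R k)^-1 * (zeta_sum (k + m) D - zeta_sum k D) =
    \sum_(0 <= i < D) (zeta R k)^-1 * i.+1%:R ^- k * (i.+1%:R^-1 ^+ m - 1).
    rewrite /zeta_sum -sumrB mulr_sumr; apply: eq_bigr => i _.
    by rewrite -exprB_natV; ring.
  apply: (@cvg_sum_nat (fun i n =>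
    gcd_freq k n i.+1 * (multiples n i.+1 ^+ m - 1))) => i.
  apply: cvgM; first exact: gcd_freq_cvg.
  by apply: cvgB; [apply: cvg_exprn; exact: multiples_cvg|exact: cvg_cst].
have -> : zeta R (k + m) / zeta R k =
    1 + (zeta R k)^-1 * (zeta R (k + m) - zeta R k) by field.
apply: (@cvgr_to_ge _ \oo _ _ (fun D => 1 + (zeta R k)^-1 * (zeta_sum (k + m) D - zeta_sum k D))).
  apply: cvgD; first exact: cvg_cst.
  by apply: cvgM; [exact: cvg_cst|apply: cvgB; exact: zeta_cvg].
by apply: nearW.
Unshelve. all: by end_near. Qed.

(** The terms are nonnegative, so those beyond D may be dropped; the remaining finite sum converges,
    and D then tends to infinity. *)
Lemma limn_inf_gcd_freq k h (C : R) (u : R^o^nat) : (1 < k)%N -> 0 <= C ->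
  (forall n, 0 <= u n <= 1) ->
  (\forall n \near \oo, C * (\sum_(0 <= i < n) gcd_freq k n i.+1 *
     ((n.*2.+1 %/ i.+1)%:R / side n) ^+ h) <= u n) ->
  C * (zeta R (k + h) / zeta R k) <= limn_inf u.
Proof.
move=> k2 C0 u01 uE.
have kh2 : (1 < k + h)%N by apply: leq_trans k2 _; exact: leq_addr.
have H D : C * ((zeta R k)^-1 * zeta_sum (k + h) D) <= limn_inf u.
  apply: (@limn_inf_ge _ (fun n => C * \sum_(0 <= i < D)
     gcd_freq k n i.+1 * ((n.*2.+1 %/ i.+1)%:R / side n) ^+ h)) => //.
    near=> n; have Dn : (D <= n)%N by near: n; exists D.
    apply: (@le_trans _ _ (C * (\sum_(0 <= i < n) gcd_freq k n i.+1 *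
     ((n.*2.+1 %/ i.+1)%:R / side n) ^+ h))); last by near: n.
    rewrite ler_wpM2l// [leRHS](@big_cat_nat _ _ _ D 0 n)//= lerDl sumr_ge0// => i _.
    by rewrite mulr_ge0 ?gcd_freq_ge0 ?exprn_ge0 ?divr_ge0 ?ler0n.
  apply: cvgM; first exact: cvg_cst.
  have -> : (zeta R k)^-1 * zeta_sum (k + h) D =
    \sum_(0 <= i < D) (zeta R k)^-1 * i.+1%:R ^- k * i.+1%:R^-1 ^+ h.
    rewrite /zeta_sum mulr_sumr; apply: eq_bigr => i _.
    by rewrite -exprB_natV; ring.
  apply: (@cvg_sum_nat (fun i n =>
    gcd_freq k n i.+1 * ((n.*2.+1 %/ i.+1)%:R / side n) ^+ h)) => i.
  apply: cvgM; first exact: gcd_freq_cvg.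
  apply: cvg_exprn; apply: ratio_cvg => // n.
  have := divn_eq n.*2.+1 i.+1; have := ltn_pmod n.*2.+1 (ltn0Sn i); lia.
apply: (@cvgr_to_le _ \oo _ _ (fun D => C * ((zeta R k)^-1 * zeta_sum (k + h) D))).
  rewrite [_ / zeta R k]mulrC; apply: cvgM; first exact: cvg_cst.
  by apply: cvgM; [exact: cvg_cst|exact: zeta_cvg].
by apply: nearW.
Unshelve. all: by end_near. Qed.

End Density.

(** * Lower central series and homomorphisms *)

Local Open Scope group_scope.
Local Open Scope quotient_scope.

Section IntegerPowers.
Variable G : groupType.
Implicit Types (x y : G) (m n : int).

Lemma expgz1 x : expgz x 1 = x.
Proof.
by [].
Qed.

Lemma expgzN x m : expgz x (- m)%R = (expgz x m)^-1.
Proof.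
by case: m => [[|n]|n] /=; rewrite ?invg1 ?invgK.
Qed.

Lemma expgzS x m : expgz x (m + 1)%R = expgz x m * x.
Proof.
case: m => [n|[|n]].
- have -> : (Posz n + 1)%R = Posz n.+1 by lia.
  by rewrite /= expgSr.
- have -> : (Negz 0 + 1)%R = Posz 0 by lia.
  by rewrite /= expg1 mulVg.
- have -> : (Negz n.+1 + 1)%R = Negz n by lia.
  by rewrite /= [x ^+ n.+2]expgS invgM mulgVK.
Qed.

Lemma expgzD x m n : expgz x (m + n)%R = expgz x m * expgz x n.
Proof.
elim/int_rec: n => [|n IH|n IH].
- by rewrite addr0 mulg1.
- by rewrite -addn1 PoszD addrA !expgzS IH mulgA.
- have E : (m + (- Posz n.+1) + 1 = m - Posz n)%R by lia.
  have E' : (- Posz n.+1 + 1 = - Posz n)%R by lia.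
  apply: (@mulIg _ x); rewrite -mulgA -expgzS -[in RHS]expgzS E' E; exact: IH.
Qed.

Lemma expgzB x m n : expgz x (m - n)%R = expgz x m / expgz x n.
Proof.
by rewrite expgzD expgzN.
Qed.

Lemma expgzM x m n : expgz x (m * n)%R = expgz (expgz x m) n.
Proof.
elim/int_rec: n => [|n IH|n IH].
- by rewrite mulr0.
- by rewrite -addn1 PoszD mulrDr mulr1 expgzS expgzD IH.
- have -> : (m * - Posz n.+1 = m * - Posz n - m)%R by lia.
  have -> : (- Posz n.+1 = - Posz n - 1)%R by lia.
  by rewrite !expgzB expgz1 IH.
Qed.

Lemma commute_expgz x y m : commute x y -> commute x (expgz y m).
Proof.
by move=> xy; case: m => n /=; [|apply: commuteV]; exact: commuteX.
Qed.

Lemma expgzMg x y m : commute x y -> expgz (x * y) m = expgz x m * expgz y m.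
Proof.
move=> xy; case: m => n /=; first exact: expgMn.
rewrite expgMn// invgM; apply: commute_sym.
by apply: commuteV; apply: commute_sym; apply: commuteV; apply: commuteX2; exact: commute_sym.
Qed.

Lemma expg1z m : expgz (1 : G) m = 1.
Proof.
by case: m => n /=; rewrite expg1n ?invg1.
Qed.

(** The convention that order 0 means infinite order makes this uniform, because 0 divides only
    0. *)
Lemma elt_orderP x m : expgz x m = 1 <-> (elt_order x %| `|m|)%N.
Proof.
have absE : expgz x m = 1 <-> x ^+ `|m|%N = 1.
  case: m => n //=; split=> [xn|->]; last by rewrite invg1.
  by apply: (@invg_inj G); rewrite xn invg1.
rewrite absE; move: (absz m) => n {absE m}.
rewrite /elt_order; case: pselect => [h|h]; last first.
  rewrite dvd0n; split=> [xn|/eqP->//]; apply/eqP.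
  case: n xn => // n xn; exfalso; apply: h; exists n.+1; rewrite xn eqxx.
  by [].
case: ex_minnP => w /andP[w0 /eqP xw] wmin.
rewrite [in X in X <-> _](divn_eq n w) expgnDr mulnC expgnA xw expg1n mul1g.
rewrite /dvdn; split=> [xr|/eqP->//]; apply/eqP.
have [//|r0] := posnP (n %% w)%N.
by have := wmin (n %% w)%N; rewrite r0 xr eqxx => /(_ isT); rewrite leqNgt ltn_pmod.
Qed.

End IntegerPowers.

Lemma elt_order_eq (G H : groupType) (x : G) (y : H) :
  (forall m, expgz x m = 1 <-> expgz y m = 1) -> elt_order x = elt_order y.
Proof.
move=> xy; apply/eqP; rewrite eqn_dvd; apply/andP; split.
  by apply/(elt_orderP x (elt_order y))/xy/elt_orderP; rewrite /= dvdnn.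
by apply/(elt_orderP y (elt_order x))/xy/elt_orderP; rewrite /= dvdnn.
Qed.

Section Morphisms.
Variables (G H : groupType) (f : G -> H).
Hypothesis fM : {morph f : x y / x * y}.

Lemma morphg1 : f 1 = 1.
Proof.
by apply: (@mulgI _ (f 1)); rewrite -fM !mulg1.
Qed.

Lemma morphgV x : f x^-1 = (f x)^-1.
Proof.
by apply: (@mulgI _ (f x)); rewrite -fM !mulgV morphg1.
Qed.

Lemma morphgz x m : f (expgz x m) = expgz (f x) m.
Proof.
have fX n : f (x ^+ n) = f x ^+ n.
  by elim: n => [|n IH]; [exact: morphg1|rewrite !expgS fM IH].
by case: m => n; rewrite /= ?morphgV fX.
Qed.

Lemma morphg_comm x y : f [~ x, y] = [~ f x, f y].
Proof.
by rewrite /commg /conjg !fM !morphgV.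
Qed.

Lemma preim_subgroup (A : set H) : is_subgroup A -> is_subgroup (f @^-1` A).
Proof.
by move=> [A1 AB]; split=> [|x y] /=; rewrite ?morphg1// fM morphgV; exact: AB.
Qed.

Lemma image_subgroup (A : set G) : is_subgroup A -> is_subgroup (f @` A).
Proof.
move=> [A1 AB]; split; first by exists 1 => //; exact: morphg1.
move=> _ _ [x Ax <-] [y Ay <-]; exists (x / y); first exact: AB.
by rewrite fM morphgV.
Qed.

Lemma morph_gamma i x : gamma G i x -> gamma H i (f x).
Proof.
rewrite /gamma; elim: i.-1 x => {i} [//|i IHi] x /=.
set A := commutator_subgroup _ _; set B := commutator_subgroup _ _ => Ax.
apply: (Ax (f @^-1` B)); first exact/preim_subgroup/generated_subgroup.
move=> _ [a [b [Aa _ ->]]] /=; apply: sub_generated.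
by exists (f a), (f b); split=> //; [exact: IHi|rewrite morphg_comm].
Qed.

End Morphisms.

Section LowerCentralSeries.
Variable G : groupType.
Implicit Types (x y : G) (i : nat).

Lemma gamma_subgroup i : is_subgroup (gamma G i).
Proof.
by case: (gamma_normal G i).
Qed.

Lemma gammaSE i : gamma G i.+2 = commutator_subgroup (gamma G i.+1) setT.
Proof.
by [].
Qed.

Lemma comm_gamma i x y : (0 < i)%N -> gamma G i x -> gamma G i.+1 [~ x, y].
Proof.
by case: i => // i _ Gx; rewrite gammaSE; apply: sub_generated; exists x, y.
Qed.

Lemma gammaS i x : gamma G i.+1 x -> gamma G i x.
Proof.
case: i => [//|i]; rewrite gammaSE; apply; first exact: gamma_subgroup.
move=> _ [a [b [Ga _ ->]]]; rewrite commgEl; apply: subgroupM.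
- exact: gamma_subgroup.
- exact: (subgroupV (gamma_subgroup _) Ga).
- exact: (gamma_normal G i.+1).2.
Qed.

Lemma gamma_le i j x : (i <= j)%N -> gamma G j x -> gamma G i x.
Proof.
by move=> /subnK <-; elim: (j - i)%N => //= n IH; rewrite addSn => /gammaS.
Qed.

Lemma expgz_in (A : set G) x m : is_subgroup A -> A x -> A (expgz x m).
Proof.
move=> sA Ax; have AX n : A (x ^+ n).
  elim: n => [|n IH]; first exact: sA.1.
  by rewrite expgS; exact: subgroupM.
by case: m => n /=; [|apply: subgroupV].
Qed.

Lemma coset1P (N : normal_subgroup G) x : coset N x = 1 <-> nsub_set N x.
Proof.
have [sN _] := nsubP N; rewrite -(morphg1 (@cosetM G N)).
split=> [/coset_eqP|Nx]; last apply/coset_eqP.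
  by rewrite mulg1 => /(subgroupV sN); rewrite invgK.
by rewrite mulg1; exact: subgroupV.
Qed.

Lemma coset_central i x (u : quotient (gammaN G i.+1)) : (0 < i)%N ->
  gamma G i x -> commute (coset _ x) u.
Proof.
move=> i0 Gx; rewrite -[u]coset_repr; apply/commgP/eqP.
by rewrite -(morphg_comm (@cosetM _ _)); apply/coset1P; exact: comm_gamma.
Qed.

Lemma gamma_quotient (N : normal_subgroup G) i (u : quotient N) :
  gamma (quotient N) i u -> exists2 x, gamma G i x & u = coset N x.
Proof.
suff H : gamma (quotient N) i `<=` coset N @` gamma G i.
  by move=> /H[x Gx <-]; exists x.
rewrite /gamma; elim: i.-1 => {u i} [|i IHi] u /=.
  by move=> _; exists (repr u) => //; exact: coset_repr.
set A := commutator_subgroup _ _; set B := commutator_subgroup _ _ => Au.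
apply: (Au (coset N @` B)).
  by apply: image_subgroup; [exact: cosetM|exact: generated_subgroup].
move=> _ [_ [b [/IHi[x Gx <-] _ ->]]].
exists [~ x, repr b]; first by apply: sub_generated; exists x, (repr b).
by rewrite (morphg_comm (@cosetM _ _)) coset_repr.
Qed.

End LowerCentralSeries.

Lemma gamma_quotient1 (G : groupType) i :
  gamma (quotient (gammaN G i)) i = [set 1].
Proof.
apply/seteqP; split=> [u /gamma_quotient[x Gx ->]|_ ->].
  exact/coset1P.
exact: (gamma_subgroup _ _).1.
Qed.

(** * Universal properties of free groups, quotients and the group of equations *)

Section Lifts.

Lemma free_lift (X : choiceType) (H : groupType) (f : X -> H) :
  exists2 phi : free_group X -> H, {morph phi : x y / x * y} &
    forall x, phi (free_gen x) = f x.
Proof.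
pose ev (w : word X) := \prod_(l <- w) (if l.2 then (f l.1)^-1 else f l.1).
have evE u v : word_eq u v -> ev u = ev v.
  elim=> {u v} // [u v w _ -> _ ->//|u v x b].
  rewrite /ev !big_cat /= !big_cons /=; congr (_ * _); rewrite mulgA.
  by case: b => /=; rewrite ?mulVg ?mulgV mul1g.
have evK w : ev (repr (of_word w)) = ev w.
  by apply: evE; apply/of_wordP; rewrite of_word_repr.
exists (fun u => ev (repr u)) => [u v|x]; last by rewrite evK /ev big_seq1.
rewrite -[u]of_word_repr -[v]of_word_repr.
have -> : of_word (repr u) * of_word (repr v) = of_word (repr u ++ repr v).
  exact: of_word_mul.
by rewrite !evK /ev big_cat.
Qed.

Lemma quotient_lift (G H : groupType) (N : normal_subgroup G) (f : G -> H) :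
  {morph f : x y / x * y} -> (forall x, nsub_set N x -> f x = 1) ->
  exists2 phi : quotient N -> H, {morph phi : x y / x * y} &
    forall x, phi (coset N x) = f x.
Proof.
move=> fM fN; have E x : f (repr (coset N x)) = f x.
  have /coset_eqP/fN : coset N (repr (coset N x)) = coset N x by exact: coset_repr.
  by rewrite fM (morphgV fM) => /mulg1_eq; rewrite invgK.
exists (fun u => f (repr u)) => // u v.
by rewrite -[u]coset_repr -[v]coset_repr -cosetM !E fM.
Qed.

Lemma free_word_ind (X : choiceType) (A : set (free_group X)) :
  is_subgroup A -> (forall x, A (free_gen x)) -> forall u, A u.
Proof.
move=> sA Ax u; rewrite -[u]of_word_repr; elim: (repr u) => [|[x b] w IH].
  exact: sA.1.
have -> : of_word ((x, b) :: w) = of_word [:: (x, b)] * of_word w.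
  exact/esym/of_word_mul.
apply: subgroupM => //; case: b; last exact: Ax.
by have := subgroupV sA (Ax x); congr (A _); exact: of_word_inv.
Qed.

Variables (G : groupType) (c k : nat).
Local Notation GX := (eqn_group G c k).

Lemma fprod_inlM (H : groupType) : {morph (@fprod_inl G H) : x y / x * y}.
Proof.
move=> x y; rewrite /fprod_inl -cosetM; apply/esym/divg1_eq.
rewrite -(morphgV (@cosetM _ _)) -cosetM; apply/coset1P => A nA SA.
by apply: SA; left; exists x, y.
Qed.

Lemma fprod_inrM (H : groupType) : {morph (@fprod_inr G H) : x y / x * y}.
Proof.
move=> x y; rewrite /fprod_inr -cosetM; apply/esym/divg1_eq.
rewrite -(morphgV (@cosetM _ _)) -cosetM; apply/coset1P => A nA SA.
by apply: SA; right; exists x, y.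
Qed.

Lemma eqn_constM : {morph (@eqn_const G c k) : x y / x * y}.
Proof.
by move=> x y; rewrite /eqn_const -cosetM fprod_inlM.
Qed.

(** The subgroup is pulled back through each layer of the presentation until it is a subgroup of a
    free group containing all generators. *)
Lemma eqn_group_ind (A : set GX) : is_subgroup A ->
  (forall g, A (eqn_const c k g)) -> (forall j, A (eqn_var G c j)) ->
  forall u, A u.
Proof.
move=> sA Ag Ax u; rewrite -[u]coset_repr.
have sA1 := preim_subgroup (@cosetM _ _) sA.
have sA2 := preim_subgroup (@cosetM _ _) sA1.
rewrite -[repr u]coset_repr; apply: (free_word_ind sA2) => -[g|y] /=.
  exact: Ag.
have sA3 := preim_subgroup (@fprod_inrM _) sA1.
have sA4 := preim_subgroup (@cosetM _ _) sA3.
by rewrite -[y]coset_repr; apply: (free_word_ind sA4) => j /=; exact: Ax.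
Qed.

Lemma eqn_group_gamma : gamma GX c.+1 = [set 1].
Proof.
exact: gamma_quotient1.
Qed.

(** The universal property of [GX] among nilpotent groups of class at most c. The lift is a bundled
    morphism because [SAT] quantifies over those. *)
Lemma eqn_group_lift (K : groupType) (f : G -> K) (h : 'I_k -> K) :
  gamma K c.+1 = [set 1] -> {morph f : x y / x * y} ->
  exists phi : {multiplicative GX -> K},
    (forall g, phi (eqn_const c k g) = f g) /\
    (forall j, phi (eqn_var G c j) = h j).
Proof.
move=> Kc fM; have [f1 f1M f1E] := free_lift h.
have [|f2 f2M f2E] := quotient_lift (N := gammaN (free_group 'I_k) c.+1) f1M.
  by move=> x /(morph_gamma f1M); rewrite Kc.
have [f3 f3M f3E] := free_lift (fun s : G + free_nilpotent c k =>
  match s with inl g => f g | inr y => f2 y end).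
have [|f4 f4M f4E] := quotient_lift
    (N := normal_closureN (free_product_relators (G := G) (H := free_nilpotent c k))) f3M.
  move=> x /(_ (f3 @^-1` [set 1])); apply.
    split; first by apply: preim_subgroup => //; split=> // ? ? -> ->; rewrite divg1.
    move=> u v /= fu; rewrite /conjg !f3M fu (morphgV f3M) mul1g mulVg//.
  move=> _ [] [a [b ->]] /=; rewrite !f3M (morphgV f3M) !f3E ?fM ?f2M.
    exact: mulgV.
  exact: mulgV.
have [|f5 f5M f5E] := quotient_lift
    (N := gammaN (free_product G (free_nilpotent c k)) c.+1) f4M.
  by move=> x /(morph_gamma f4M); rewrite Kc.
have [phi phiE] : exists phi : {multiplicative GX -> K}, phi =1 f5.
  pose m := isMultiplicative.Build GX K f5 f5M.
  by exists (HB.pack_for (Multiplicative.type GX K) f5 m).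
exists phi; split=> [g|j]; rewrite phiE f5E f4E f3E//.
by rewrite f2E f1E.
Qed.

End Lifts.

(** * Bases, normal forms and frequencies *)

Section PowerProducts.
Variable K : groupType.
Implicit Types (s t : seq K) (z : seq int) (A B C : set K).

Definition powprod s z : K := \prod_(p <- zip s z) expgz p.1 p.2.

Lemma powprod_nil z : powprod [::] z = 1.
Proof.
by rewrite /powprod; case: z => [|a z]; rewrite big_nil.
Qed.

Lemma powprod_cons x s a z : powprod (x :: s) (a :: z) = expgz x a * powprod s z.
Proof.
by rewrite /powprod /= big_cons.
Qed.

Lemma powprod_cat s t z z' : size z = size s -> powprod (s ++ t) (z ++ z') = powprod s z * powprod t z'.
Proof.
by move=> sz; rewrite /powprod zip_cat// big_cat.
Qed.

Lemma powprod_in s z A : is_subgroup A -> {in s, forall x, A x} -> A (powprod s z).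
Proof.
move=> sA; elim: s z => [|x s IH] [|a z] As; rewrite ?powprod_nil ?powprod_cons.
1,2: exact: sA.1.
  by rewrite /powprod big_nil; exact: sA.1.
apply: subgroupM => //; first by apply: expgz_in => //; apply: As; rewrite mem_head.
by apply: IH => y ys; apply: As; rewrite inE ys orbT.
Qed.

Lemma powprod_commute s z x : {in s, forall y, commute x y} -> commute x (powprod s z).
Proof.
elim: s z => [|y s IH] [|a z] xs; rewrite ?powprod_nil ?powprod_cons; try exact: commute1.
  by rewrite /powprod big_nil; exact: commute1.
apply: commuteM; first by apply: commute_expgz; apply: xs; rewrite mem_head.
by apply: IH => y' ys; apply: xs; rewrite inE ys orbT.
Qed.

Definition commuting s := {in s &, forall x y, commute x y}.

Lemma commuting_cons x s : commuting (x :: s) ->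
  {in s, forall y, commute x y} /\ commuting s.
Proof.
move=> cs; split=> [y ys|y y' ys ys']; apply: cs; rewrite inE ?eqxx ?ys ?ys' ?orbT//.
Qed.

Lemma powprod_add s z z' : commuting s -> size z = size s -> size z' = size s ->
  powprod s [seq (p.1 + p.2)%R | p <- zip z z'] = powprod s z * powprod s z'.
Proof.
elim: s z z' => [|x s IH] [|a z] [|a' z'] //= cs; rewrite ?powprod_nil ?mul1g//.
move=> [sz] [sz']; have [xs {}cs] := commuting_cons cs.
rewrite !powprod_cons IH// expgzD !mulgA; congr (_ * _); rewrite -!mulgA; congr (_ * _).
by apply: powprod_commute => y ys; apply/commute_sym/commute_expgz/commute_sym/xs.
Qed.

Lemma powprod_scale s z m : commuting s ->
  powprod s [seq (m * a)%R | a <- z] = expgz (powprod s z) m.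
Proof.
elim: s z => [|x s IH] [|a z] cs /=; rewrite ?powprod_nil ?expg1z//.
  by rewrite /powprod big_nil expg1z.
have [xs {}cs] := commuting_cons cs; rewrite !powprod_cons IH// mulrC expgzM expgzMg//.
by apply: powprod_commute => y ys; apply/commute_sym/commute_expgz/commute_sym/xs.
Qed.

Lemma powprod_nth s z : size z = size s ->
  powprod s z = \prod_(0 <= i < size s) expgz (nth 1 s i) (nth 0%R z i).
Proof.
move=> sz; rewrite /powprod (big_nth (1, 0%R)) size_zip sz minnn.
by rewrite big_nat [RHS]big_nat; apply: eq_bigr => i _; rewrite nth_zip.
Qed.

(* Independence of the cyclic factors, for exponents that are not reduced. *)
Record basis C s : Prop := Basis {
  basis_comm : commuting s;
  basis_sub : forall z, size z = size s -> C (powprod s z);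
  basis_gen : forall x, C x -> exists2 z, size z = size s & x = powprod s z;
  basis_indep : forall z, size z = size s -> powprod s z = 1 ->
    all (fun p => elt_order p.1 %| `|p.2|)%N (zip s z) }.

Lemma is_base_basis C s : is_base C s -> basis C s.
Proof.
move=> [_ []]; set Hs := [seq range (expgz x) | x <- s].
have sH : size Hs = size s by rewrite size_map.
have HE (i : 'I_(size Hs)) : nth set0 Hs i = range (expgz (nth 1 s i)).
  by rewrite (nth_map 1)// -sH.
move=> _ Hc HC Hi.
have pE z : size z = size s ->
    powprod s z = \prod_(i < size Hs) expgz (nth 1 s i) (nth 0%R z i).
  by move=> sz; rewrite powprod_nth// -sH big_mkord.
split.
- move=> x y xs ys; have [->//|xy] := eqVneq x y.
  have xi : (index x s < size Hs)%N by rewrite sH index_mem.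
  have yi : (index y s < size Hs)%N by rewrite sH index_mem.
  apply: (Hc (Ordinal xi) (Ordinal yi)).
  + apply: contra_neq xy => /(congr1 val) /= xy.
    by rewrite -(nth_index 1 xs) xy nth_index.
  + by rewrite HE /= nth_index//; exists 1%R => //; exact: expgz1.
  + by rewrite HE /= nth_index//; exists 1%R => //; exact: expgz1.
- move=> z sz; rewrite HC pE//.
  exists (fun i : 'I_(size Hs) => expgz (nth 1 s i) (nth 0%R z i)) => // i.
  by rewrite HE; exists (nth 0%R z i).
- move=> x; rewrite HC => -[f fH ->].
  have /choice[g gE] : forall i : 'I_(size Hs), exists a : int,
      expgz (nth 1 s i) a = f i.
    by move=> i; have := fH i; rewrite HE => -[a _ <-]; exists a.
  have sz : size [seq g i | i <- enum 'I_(size Hs)] = size s.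
    by rewrite size_map size_enum_ord.
  exists [seq g i | i <- enum 'I_(size Hs)] => //.
  rewrite pE//; apply: eq_bigr => i _.
  by rewrite (nth_map i) ?size_enum_ord// nth_ord_enum gE.
- move=> z sz; rewrite pE// => z1; apply/(all_nthP (1, 0%R)) => i.
  rewrite size_zip sz minnn -sH => iH; rewrite nth_zip//=; apply/elt_orderP.
  have := Hi (fun i : 'I_(size Hs) => expgz (nth 1 s i) (nth 0%R z i)) (fun=> 1).
  rewrite z1 big1// => /(_ _ _ _ (Ordinal iH)); apply=> // j; rewrite HE.
    by exists (nth 0%R z j).
  by exists 0%R.
Qed.

Lemma direct_product2 C A B : is_direct_product C [:: A; B] ->
  [/\ forall a b, A a -> B b -> commute a b,
      forall x, C x <-> exists a b, [/\ A a, B b & x = a * b]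
    & forall a b, A a -> B b -> a * b = 1 -> a = 1 /\ b = 1].
Proof.
move=> [sH Hc HC Hi].
pose fn a b (i : 'I_2) := if i == ord0 then a else b : K.
have fnH a b : A a -> B b -> forall i : 'I_2, nth set0 [:: A; B] i (fn a b i).
  by move=> Aa Bb [[|[|]]].
have fnE a b : \prod_(i < 2) fn a b i = a * b.
  by rewrite big_ord_recl big_ord1.
split.
- move=> a b Aa Bb; exact: (Hc ord0 (lift ord0 ord0)).
- move=> x; rewrite HC; split=> [[f fH ->]|[a [b [Aa Bb ->]]]].
    exists (f ord0), (f (lift ord0 ord0)).
    by split; [exact: (fH ord0)|exact: (fH (lift ord0 ord0))|rewrite big_ord_recl big_ord1].
  by exists (fn a b); [exact: fnH|rewrite fnE].
- move=> a b Aa Bb ab; have A1 : A 1 := (sH ord0).1.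
  have B1 : B 1 := (sH (lift ord0 ord0)).1.
  have := Hi (fn a b) (fn 1 1) (fnH _ _ Aa Bb) (fnH _ _ A1 B1).
  by rewrite !fnE ab mulg1 => /(_ erefl) E; split; [exact: (E ord0)|exact: (E (lift ord0 ord0))].
Qed.

Lemma powprod_nseq0 s n : powprod s (nseq n 0%R) = 1.
Proof.
elim: s n => [|x s IH] [|n]; rewrite ?powprod_nil//= ?powprod_cons ?IH ?mulg1//.
by rewrite /powprod big_nil.
Qed.

Lemma basis_mem C s : basis C s -> {in s, forall x, C x}.
Proof.
move=> bC x /splitPr xs; case: xs bC => s1 s2 bC.
have -> : x = powprod (s1 ++ x :: s2) (nseq (size s1) 0 ++ 1 :: nseq (size s2) 0)%R.
  by rewrite powprod_cat ?size_nseq// powprod_cons !powprod_nseq0 mul1g mulg1.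
by apply: (basis_sub bC); rewrite !size_cat /= !size_nseq.
Qed.

(** The direct product lists the constants first, whereas the base puts b_i before d_i; the two
    factors commute. *)
Lemma basis_cat C A B s t : is_direct_product C [:: A; B] ->
  basis A s -> basis B t -> basis C (t ++ s).
Proof.
move=> /direct_product2[AB CE ABi] bA bB.
have memA := basis_mem bA; have memB := basis_mem bB.
have split_size z : size z = size (t ++ s) ->
    size (take (size t) z) = size t /\ size (drop (size t) z) = size s.
  by rewrite size_cat => sz; rewrite size_takel ?size_drop sz ?addKn// leq_addr.
split.
- move=> x y; rewrite !mem_cat => /orP[xt|xs] /orP[yt|ys].
  + exact: (basis_comm bB).
  + by apply/commute_sym/AB; [exact: memA|exact: memB].
  + by apply/AB; [exact: memA|exact: memB].
  + exact: (basis_comm bA).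
- move=> z /split_size[z1 z2]; rewrite -[z](cat_take_drop (size t)) powprod_cat//.
  apply/CE; exists (powprod s (drop (size t) z)), (powprod t (take (size t) z)).
  have As := basis_sub bA z2; have Bt := basis_sub bB z1.
  by split=> //; exact/esym/AB.
- move=> _ /CE[_ [_ [/(basis_gen bA)[z2 sz2 ->] /(basis_gen bB)[z1 sz1 ->] ->]]].
  exists (z1 ++ z2); first by rewrite !size_cat sz1 sz2.
  by rewrite powprod_cat//; apply: AB; [exact: (basis_sub bA)|exact: (basis_sub bB)].
- move=> z /split_size[z1 z2]; rewrite -[z](cat_take_drop (size t)) powprod_cat//.
  have As := basis_sub bA z2; have Bt := basis_sub bB z1.
  rewrite -(AB _ _ As Bt) => /(ABi _ _ As Bt)[p2 p1].
  by rewrite zip_cat// all_cat (basis_indep bB)// (basis_indep bA).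
Qed.

End PowerProducts.

Lemma morph_powprod (K L : groupType) (f : K -> L) (s : seq K) z :
  {morph f : x y / x * y} -> f (powprod s z) = powprod [seq f x | x <- s] z.
Proof.
move=> fM; elim: s z => [|x s IH] [|a z] /=; rewrite ?powprod_nil ?(morphg1 fM)//.
  by rewrite /powprod !big_nil (morphg1 fM).
by rewrite !powprod_cons fM (morphgz fM) IH.
Qed.

Lemma morph_elt_order (K L : groupType) (f : K -> L) x :
  {morph f : x y / x * y} -> (forall x, f x = 1 -> x = 1) ->
  elt_order (f x) = elt_order x.
Proof.
move=> fM fI; apply: elt_order_eq => m; rewrite -(morphgz fM).
by split=> [/fI//|->]; exact: (morphg1 fM).
Qed.

Lemma basis_image (K L : groupType) (f : K -> L) (C : set K) s :
  {morph f : x y / x * y} -> (forall x, f x = 1 -> x = 1) ->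
  basis C s -> basis (f @` C) [seq f x | x <- s].
Proof.
move=> fM fI bC; split.
- move=> _ _ /mapP[x xs ->] /mapP[y ys ->].
  by rewrite /commute -!fM (basis_comm bC).
- move=> z; rewrite size_map => sz; rewrite -morph_powprod//; exists (powprod s z) => //.
  exact: (basis_sub bC).
- move=> _ [x /(basis_gen bC)[z sz ->] <-].
  by exists z; rewrite ?size_map//; exact: morph_powprod.
- move=> z; rewrite size_map => sz; rewrite -morph_powprod// => /fI/(basis_indep bC sz).
  have -> : zip [seq f x | x <- s] z = [seq (f p.1, p.2) | p <- zip s z].
    by elim: s z {bC sz} => [|x s IH] [|a z] //=; rewrite IH.
  by rewrite all_map; apply: sub_all => p /=; rewrite (morph_elt_order _ fM fI).
Qed.

Section ReducedExponents.
Variable K : groupType.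
Implicit Types (s : seq K) (z : seq int) (ws : seq nat).

Definition reduced ws z :=
  (size z == size ws) && all (fun p => in_Zomega p.1 p.2) (zip ws z).

Lemma reduced_cons w ws a z :
  reduced (w :: ws) (a :: z) = in_Zomega w a && reduced ws z.
Proof.
by rewrite /reduced /= eqSS andbCA.
Qed.

Lemma reduced_cat ws ws' z z' : size z = size ws ->
  reduced (ws ++ ws') (z ++ z') = reduced ws z && reduced ws' z'.
Proof.
move=> sz; rewrite /reduced !size_cat zip_cat// all_cat sz eqn_add2l eqxx /=.
by rewrite andbCA.
Qed.

Lemma reduced_size ws z : reduced ws z -> size z = size ws.
Proof.
by move=> /andP[/eqP].
Qed.

Lemma reduced_exists s z : size z = size s ->
  exists2 z', reduced [seq elt_order x | x <- s] z' & powprod s z' = powprod s z.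
Proof.
elim: s z => [|x s IH] [|a z] //=; first by exists [::].
move=> [/IH[z' rz' zE]]; pose w := elt_order x.
(* For infinite order w is 0 and [a %% 0] is a, so the exponent is left as it is. *)
exists ((a %% w)%Z :: z'); last first.
  rewrite !powprod_cons zE; congr (_ * _).
  transitivity (expgz x (w%:Z * (a %/ w)%Z + (a %% w)%Z)%R); last first.
    by rewrite mulrC -divz_eq.
  move: (a %% w)%Z (a %/ w)%Z => r q; rewrite expgzD expgzM.
  have -> : expgz x w = 1 by apply/elt_orderP; rewrite /= dvdnn.
  by rewrite expg1z mul1g.
rewrite reduced_cons rz' andbT /in_Zomega -/w; case: eqP => //= w0.
by rewrite modz_ge0 ?ltz_pmod//; lia.
Qed.

Lemma in_Zomega_inj w (a b : int) : in_Zomega w a -> in_Zomega w b ->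
  (w %| absz (a - b)%R)%N -> a = b.
Proof.
rewrite /in_Zomega; case: eqP => [->|w0] /=.
  by rewrite dvd0n absz_eq0 subr_eq0 => _ _ /eqP.
move=> aw bw /dvdnP[[|q] qE]; first by lia.
by move: qE; rewrite mulSn; lia.
Qed.

(** Independence applied to the difference of the two exponent vectors makes each entry divisible by
    the order of its element; reduced exponents congruent modulo the order are equal. *)
Lemma reduced_unique (C : set K) s z z' : basis C s ->
  reduced [seq elt_order x | x <- s] z -> reduced [seq elt_order x | x <- s] z' ->
  powprod s z = powprod s z' -> z = z'.
Proof.
move=> bC rz rz' zz'.
have sz : size z = size s by rewrite (reduced_size rz) size_map.
have sz' : size z' = size s by rewrite (reduced_size rz') size_map.
have sNz' : size [seq (-1 * a)%R | a <- z'] = size s by rewrite size_map.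
have := basis_indep bC (z := [seq (p.1 + p.2)%R | p <- zip z [seq (-1 * a)%R | a <- z']]).
rewrite size_map size_zip sz sNz' minnn => /(_ erefl).
have cs := basis_comm bC.
rewrite powprod_add// powprod_scale// zz' mulgV => /(_ erefl).
elim: s z z' rz rz' {bC sz sz' sNz' zz' cs} => [|x s IH] [|a z] [|b z'] //=.
rewrite !reduced_cons => /andP[wa rz] /andP[wb rz'] /andP[ab zz'].
congr (_ :: _); last exact: IH.
by apply: in_Zomega_inj wa wb _; move: ab; rewrite mulN1r.
Qed.

Lemma normal_formE (e : seq (K * nat)) u z : normal_form e u z <->
  reduced (unzip2 e) z /\ u = powprod (unzip1 e) z.
Proof.
have -> : powprod (unzip1 e) z = \prod_(p <- zip e z) expgz p.1.1 p.2.
  elim: e z => [|x e IH] [|a z] /=; rewrite ?powprod_nil ?big_nil//.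
    by rewrite /powprod big_nil.
  by rewrite powprod_cons big_cons /= IH.
rewrite /normal_form /reduced.
have <- : all (fun p => in_Zomega p.1.2 p.2) (zip e z) =
    all (fun p => in_Zomega p.1 p.2) (zip (unzip2 e) z).
  by elim: e z => [|x e IH] [|a z] //=; rewrite IH.
rewrite size_map; split=> [[-> -> ->]|[/andP[/eqP-> ->] ->]] //.
by rewrite eqxx.
Qed.

End ReducedExponents.

(** * Normal forms along the lower central series *)

Section LowerCentralCoordinates.
Variables (K : groupType) (c : nat) (S : nat -> seq K).
Hypothesis Kc : gamma K c.+1 = [set 1].
Hypothesis S_base : forall i, (0 < i <= c)%N ->
  {in S i, forall y, gamma K i y} /\
  basis (lc_factor K i) [seq coset _ y | y <- S i].

Definition levels j n : seq (K * nat) :=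
  flatten [seq [seq (y, omega i y) | y <- S i] | i <- iota j n].

Lemma levels_cons j n :
  levels j n.+1 = [seq (y, omega j y) | y <- S j] ++ levels j.+1 n.
Proof.
by [].
Qed.

Lemma levelsS j n :
  unzip1 (levels j n.+1) = S j ++ unzip1 (levels j.+1 n) /\
  unzip2 (levels j n.+1) = [seq omega j y | y <- S j] ++ unzip2 (levels j.+1 n).
Proof.
by rewrite /levels /= /unzip1 /unzip2 !map_cat -!map_comp map_id.
Qed.

Lemma omega_elt_order j : [seq omega j y | y <- S j] =
  [seq elt_order x | x <- [seq coset (gammaN K j.+1) y | y <- S j]].
Proof.
by rewrite -map_comp.
Qed.

Let level_bound j n : (0 < j)%N -> (j + n.+1 = c.+1)%N -> (0 < j <= c)%N.
Proof.
lia.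
Qed.

Lemma levels_mem j n : (0 < j)%N -> (j + n = c.+1)%N ->
  {in unzip1 (levels j n), forall x, gamma K j x}.
Proof.
elim: n j => [|n IH] j j0 jn x //; rewrite (levelsS j n).1 mem_cat.
have jc := level_bound j0 jn.
move=> /orP[/(S_base jc).1//|xl]; apply: gammaS.
by apply: IH xl; rewrite // addSnnS.
Qed.

Lemma levels_in j n z : (0 < j)%N -> (j + n = c.+1)%N ->
  gamma K j (powprod (unzip1 (levels j n)) z).
Proof.
by move=> j0 jn; apply: powprod_in; [exact: gamma_subgroup|exact: levels_mem].
Qed.

(** The image modulo the next term determines the exponents of level j; dividing by their product
    leaves an element of [gamma K j.+1], and the recursion ends in the trivial group. *)
Lemma levels_exists j n u : (0 < j)%N -> (j + n = c.+1)%N -> gamma K j u ->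
  exists2 z, reduced (unzip2 (levels j n)) z & u = powprod (unzip1 (levels j n)) z.
Proof.
elim: n j u => [|n IH] j u j0 jn Gu.
  exists [::] => //; rewrite powprod_nil.
  by move: Gu; rewrite -[j]addn0 jn Kc.
have jc := level_bound j0 jn; have [memS bS] := S_base jc.
have /(basis_gen bS)[z sz zE] : lc_factor K j (coset _ u) by exists u.
have [z0 rz0 z0E] := reduced_exists sz.
have sz0 : size z0 = size (S j) by rewrite (reduced_size rz0) !size_map.
have Gv : gamma K j.+1 ((powprod (S j) z0)^-1 * u).
  apply/(coset1P (gammaN K j.+1)).
  by rewrite cosetM (morphgV (@cosetM _ _)) morph_powprod ?z0E -?zE ?mulVg//; exact: cosetM.
have [|z1 rz1 vE] := IH j.+1 _ isT _ Gv; first by rewrite addSnnS.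
exists (z0 ++ z1); rewrite ?(levelsS j n).1 ?(levelsS j n).2.
  by rewrite reduced_cat ?size_map// omega_elt_order rz0.
by rewrite powprod_cat// -vE mulVKg.
Qed.

(** Modulo [gamma K j.+1] only level j is visible, so its exponents agree; the common factor is
    cancelled and the next level treated. *)
Lemma levels_unique j n z z' : (0 < j)%N -> (j + n = c.+1)%N ->
  reduced (unzip2 (levels j n)) z -> reduced (unzip2 (levels j n)) z' ->
  powprod (unzip1 (levels j n)) z = powprod (unzip1 (levels j n)) z' -> z = z'.
Proof.
elim: n j z z' => [|n IH] j z z' j0 jn.
  by move=> /reduced_size/size0nil -> /reduced_size/size0nil ->.
have jc := level_bound j0 jn; have [memS bS] := S_base jc.
rewrite (levelsS j n).1 (levelsS j n).2 omega_elt_order => rz rz'.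
have jn' : (j.+1 + n = c.+1)%N by rewrite addSnnS.
have split_z y :
    reduced ([seq elt_order x | x <- [seq coset (gammaN K j.+1) x | x <- S j]]
       ++ unzip2 (levels j.+1 n)) y ->
  exists y1 y2, [/\ y = y1 ++ y2, size y1 = size (S j), reduced [seq elt_order x |
    x <- [seq coset (gammaN K j.+1) x | x <- S j]] y1 &
    reduced (unzip2 (levels j.+1 n)) y2].
  move=> ry; exists (take (size (S j)) y), (drop (size (S j)) y).
  have sy : size (take (size (S j)) y) = size (S j).
    by rewrite size_takel// (reduced_size ry) size_cat !size_map leq_addr.
  rewrite cat_take_drop; move: ry.
  by rewrite -{1}[y](cat_take_drop (size (S j))) reduced_cat ?size_map// => /andP[].
have [z1 [z2 [-> sz1 rz1 rz2]]] := split_z _ rz.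
have [z1' [z2' [-> sz1' rz1' rz2']]] := split_z _ rz'.
rewrite !powprod_cat// => E; have E1 : z1 = z1'.
  apply: (reduced_unique bS) => //; rewrite -!morph_powprod; try exact: cosetM.
  have := congr1 (coset (gammaN K j.+1)) E; rewrite !cosetM.
  have tail y : coset (gammaN K j.+1) (powprod (unzip1 (levels j.+1 n)) y) = 1.
    by apply/coset1P; exact: levels_in.
  by rewrite !tail !mulg1.
by move: E; rewrite E1 => /mulgI E; rewrite (IH j.+1 z2 z2').
Qed.

End LowerCentralCoordinates.

Section Frequencies.
Variables (R : realType) (K : groupType) (e : seq (K * nat)).
Hypothesis nf_exists : forall u, exists2 z, reduced (unzip2 e) z & u = powprod (unzip1 e) z.
Hypothesis nf_unique : forall z z', reduced (unzip2 e) z -> reduced (unzip2 e) z' ->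
  powprod (unzip1 e) z = powprod (unzip1 e) z' -> z = z'.

Lemma norm_powprod z : reduced (unzip2 e) z ->
  norm e (powprod (unzip1 e) z) = (\max_(a <- z) `|a|)%N.
Proof.
move=> rz; rewrite /norm; suff -> : coords e (powprod (unzip1 e) z) = z by [].
apply: xget_unique => [|z' /normal_formE[rz' /esym E]].
  by apply/normal_formE.
exact: nf_unique E.
Qed.

(** Uniqueness of normal forms makes [powprod] a bijection from the box to the ball. Listing the
    image also shows that the set is finite, without which [fset_set] would return the empty set. *)
Lemma card_norm_ball (A : set K) n :
  #|` fset_set (A `&` norm_ball e n)| =
  count (fun z => `[< A (powprod (unzip1 e) z) >]) (box (unzip2 e) n).
Proof.
set s := [seq powprod (unzip1 e) z | z <-
  [seq z <- box (unzip2 e) n | `[< A (powprod (unzip1 e) z) >]]].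
have box_reduced z : z \in box (unzip2 e) n ->
    reduced (unzip2 e) z /\ all (fun a : int => `|a| <= n)%N z.
  by rewrite mem_box andbA => /andP[].
have sE : A `&` norm_ball e n = [set` s].
  apply/seteqP; split=> u /=.
    move=> [Au]; have [z rz uE] := nf_exists u.
    rewrite /norm_ball /= uE norm_powprod// => zn; apply/mapP; exists z => //.
    rewrite mem_filter; apply/andP; split; first by apply/asboolP; rewrite -uE.
    rewrite mem_box andbA; apply/andP; split=> //; apply/allP => a az.
    by apply: leq_trans zn; rewrite (big_rem a)//= leq_max leqnn.
  move=> /mapP[z]; rewrite mem_filter => /andP[/asboolP Az /box_reduced[rz zn]] ->.
  split=> //; rewrite /norm_ball /= norm_powprod//.
  by apply/bigmax_leqP_seq => a az _; have /allP/(_ _ az) := zn.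
have us : uniq s.
  rewrite map_inj_in_uniq ?filter_uniq ?box_uniq// => z z'.
  rewrite !mem_filter => /andP[_ /box_reduced[rz _]] /andP[_ /box_reduced[rz' _]].
  exact: nf_unique.
rewrite sE -size_filter -(size_map (powprod (unzip1 e))) -/s.
apply: perm_size; apply: uniq_perm => // u.
rewrite in_fset_set; last exact: finite_seq.
by apply/idP/idP; rewrite inE.
Qed.

Lemma rhoE (A : set K) n : rho e R A n =
  ((count (fun z => `[< A (powprod (unzip1 e) z) >]) (box (unzip2 e) n))%:R /
   (size (box (unzip2 e) n))%:R)%R.
Proof.
rewrite /rho card_norm_ball; congr (_ / _%:R)%R.
rewrite -[norm_ball e n]setTI card_norm_ball -[RHS]count_predT.
by apply: eq_count => z /=; apply/asboolP.
Qed.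

End Frequencies.

(** * Hirsch length *)

Section FiniteIndex.
Variable K : groupType.
Implicit Types (A B N M : set K) (x y : K).

(* [N] need not be contained in [A]. *)
Definition finite_index A N : Prop :=
  exists s : seq K, forall x, A x -> exists2 y, y \in s & N (y^-1 * x).

Lemma finite_index_sub A A' N N' : A' `<=` A -> N `<=` N' ->
  finite_index A N -> finite_index A' N'.
Proof.
by move=> AA NN [s sP]; exists s => x /AA/sP[y ys /NN]; exists y.
Qed.

Lemma finite_index_refl A N : N 1 -> A `<=` N -> finite_index A N.
Proof.
by move=> N1 AN; exists [:: 1] => x /AN Nx; exists 1; rewrite ?mem_head// invg1 mul1g.
Qed.

Lemma finite_index_trans A N M :
  finite_index A N -> finite_index N M -> finite_index A M.
Proof.
move=> [s sP] [t tP]; exists [seq y * u | y <- s, u <- t] => x /sP[y ys /tP[u ut Mu]].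
exists (y * u); first exact: allpairs_f.
by rewrite invgM -mulgA.
Qed.

Lemma finite_index_setI A N : is_subgroup A -> is_subgroup N ->
  finite_index A N -> finite_index A (A `&` N).
Proof.
move=> sA sN [s sP].
(* The given representatives may lie outside A; each is replaced by an element of A in the same
   coset of N. The default 1 serves only cosets that do not meet A. *)
pose r y := xget 1 [set x | A x /\ N (y^-1 * x)].
exists [seq r y | y <- s] => x Ax; have [y ys Nyx] := sP x Ax.
exists (r y); first exact: map_f.
have [Ar Nr] : A (r y) /\ N (y^-1 * r y).
  by apply: (@xgetPex _ 1 [set x | A x /\ N (y^-1 * x)]); exists x.
split; first by apply: subgroupM => //; exact: subgroupV.
have -> : (r y)^-1 * x = (y^-1 * r y)^-1 * (y^-1 * x).
  by rewrite invgM invgK mulgA mulgK.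
by apply: subgroupM => //; exact: subgroupV.
Qed.

Lemma finite_cosets A N : is_subgroup N ->
  finite_set (cosets A N) <-> finite_index A N.
Proof.
move=> sN; have cosetE x y : N (y^-1 * x) ->
    [set x * z | z in N] = [set y * z | z in N].
  move=> Nyx; apply/seteqP; split=> _ [z Nz <-].
    exists (y^-1 * x * z); first exact: subgroupM.
    by rewrite -!mulgA mulVKg.
  exists ((y^-1 * x)^-1 * z); first by apply: subgroupM => //; exact: subgroupV.
  by rewrite invgM invgK -!mulgA mulVKg.
split=> [/finite_seqP[s sE]|[s sP]].
  exists [seq xget 1 t | t <- s] => x Ax.
  have xs : [set x * z | z in N] \in s.
    have : cosets A N [set x * z | z in N] by exists x.
    by rewrite sE.
  exists (xget 1 [set x * z | z in N]); first exact: map_f.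
  have : [set x * z | z in N] x by exists 1; [exact: sN.1|rewrite mulg1].
  move=> /(@xgetI _ 1)[z Nz <-].
  by rewrite invgM mulgVK; exact: subgroupV.
apply: (@sub_finite_set _ _ [set [set y * z | z in N] | y in [set` s]]).
  by move=> _ [x /sP[y ys Nyx] <-]; exists y => //; apply/esym/cosetE.
exact/finite_image/finite_seq.
Qed.

End FiniteIndex.

Section HirschLength.
Variable K : groupType.
Implicit Types (A B : set K) (h : nat).

Definition cyclic_step A A' (g : K) : Prop :=
  [/\ A' `<=` A, forall x y, A' x -> A y -> A' (x ^ y), A g
    & forall x, A x -> exists m, A' ((expgz g m)^-1 * x)].

(** A polycyclic series built from the bottom, together with the number of its infinite factors;
    this form supports induction on the series. *)
Inductive hirsch : set K -> nat -> Prop :=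
| hirsch1 : hirsch [set 1] 0
| hirschS A A' g h : is_subgroup A -> hirsch A' h -> cyclic_step A A' g ->
    hirsch A (`[< ~ finite_index A A' >] + h).

Lemma hirsch_subgroup A h : hirsch A h -> is_subgroup A.
Proof.
by case=> // {A h}; split=> // x y -> ->; rewrite divg1.
Qed.

(** As A' is normalized by A, congruence modulo A' is compatible with powers; the conjugations in
    the proof move the factors from A' past powers of [b]. *)
Lemma cyclic_step_congX A A' g a m t : is_subgroup A -> is_subgroup A' ->
  cyclic_step A A' g -> A a -> A' ((expgz g m)^-1 * a) ->
  A' ((expgz g (m * t)%R)^-1 * expgz a t).
Proof.
move=> sA sA' [_ nA Ag _] Aa; set b := expgz g m => ba; rewrite expgzM -/b.
have Ab : A b by exact: expgz_in.
have congX n : A' ((b ^+ n)^-1 * a ^+ n).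
  elim: n => [|n IH]; first by rewrite !expg0 invg1 mulg1; exact: sA'.1.
  rewrite !expgSr invgM.
  have -> : b^-1 * (b ^+ n)^-1 * (a ^+ n * a) =
      ((b ^+ n)^-1 * a ^+ n) ^ b * (b^-1 * a).
    by rewrite /conjg -!mulgA mulVKg.
  by apply: subgroupM => //; exact: nA.
case: t => n /=; first exact: congX.
have := nA _ (b ^+ n.+1)^-1 (subgroupV sA' (congX n.+1)).
rewrite /conjg invgM !invgK -!mulgA mulgV mulg1; apply.
by apply: subgroupV => //; exact: (expgz_in (Posz n.+1)).
Qed.

(* The weight of a subgroup is the number of infinite factors cut out on it by
   a fixed series of [B]. *)
Lemma hirsch_weight B h : hirsch B h -> exists2 k : set K -> nat, k B = h &
  forall A A', is_subgroup A -> is_subgroup A' -> A' `<=` A -> A `<=` B ->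
    (k A' <= k A)%N /\ ((k A <= k A')%N -> finite_index A A').
Proof.
elim=> {B h} [|B B' g h sB HB' [k kB' kP] st].
  exists (fun=> 0%N) => // A A' sA sA' AA AB; split=> // _.
  by apply: finite_index_refl; [exact: sA'.1|move=> x /AB ->; exact: sA'.1].
have sB' := hirsch_subgroup HB'; have [BB nB Bg cB] := st.
(* The top factor contributes 1 when the image of A in the cyclic quotient of B by B' is infinite;
   the rest is the weight of the part of A inside B'. *)
exists (fun A => (`[< ~ finite_index A B' >] + k (A `&` B'))%N).
  congr (_ + _)%N; rewrite -kB'; congr k.
  by apply/seteqP; split=> [x []|x B'x] //; split=> //; exact: BB.
have sI A : is_subgroup A -> is_subgroup (A `&` B').
  move=> sA; split; first by split; [exact: sA.1|exact: sB'.1].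
  by move=> x y [Ax Bx] [Ay By]; split; [exact: sA.2|exact: sB'.2].
move=> A A' sA sA' AA AB.
have [k1 k2] := kP (A `&` B') (A' `&` B') (sI _ sA) (sI _ sA') (@setSI _ B' _ _ AA) (@subIsetr _ _ _).
have mono : finite_index A B' -> finite_index A' B'.
  exact: finite_index_sub.
case: (pselect (finite_index A B')) => fA.
  have fA' := mono fA.
  have E X : finite_index X B' -> `[< ~ finite_index X B' >] = false.
    by move=> fX; apply/asboolP; exact.
  rewrite !E// !add0n; split=> // /k2 fi.
  apply: finite_index_trans (finite_index_setI sA sB' fA) _.
  by apply: finite_index_sub fi => // x [].
have -> : `[< ~ finite_index A B' >] = true by apply/asboolP.
split; first by apply: leq_add => //; exact: leq_b1.
case: (pselect (finite_index A' B')) => fA'.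
  have -> : `[< ~ finite_index A' B' >] = false by apply/asboolP; exact.
  by rewrite add1n add0n ltnNge k1.
have -> : `[< ~ finite_index A' B' >] = true by apply/asboolP.
rewrite leq_add2l => /k2[T TP].
(* In the remaining case A' also has infinite image in the cyclic quotient, so it contains some a
   congruent to a nonzero power of g; otherwise A' would lie in B'. *)
have [a A'a [m m0 am]] : exists2 a, A' a & exists2 m, m != 0%R &
    B' ((expgz g m)^-1 * a).
  apply: contrapT => na; apply: fA'; apply: finite_index_refl; first exact: sB'.1.
  move=> a A'a; have [m am] := cB a (AB _ (AA _ A'a)).
  have [m0|m0] := eqVneq m 0%R; first by move: am; rewrite m0 /= invg1 mul1g.
  by case: na; exists a => //; exists m.
(* An element of A congruent to [g ^ r], when there is one. Such elements for r below the absolute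
   value of m, times the representatives T inside B', will represent A modulo A'. *)
pose y (r : nat) := xget 1 [set x | A x /\ B' ((expgz g r)^-1 * x)].
exists [seq y r * u | r <- iota 0 `|m|, u <- T] => x Ax.
have [q xq] := cB x (AB _ Ax).
(* Division with remainder: multiplying x by the inverse of [a ^ t], an element of A', reduces the
   exponent q of g to r. *)
pose t := (q %/ m)%Z; pose r := absz (q %% m)%Z.
have rE : Posz r = (q %% m)%Z by rewrite /r gez0_abs// modz_ge0.
have at_ := cyclic_step_congX t sB sB' st (AB _ (AA _ A'a)) am.
have A'at : A' (expgz a t) by exact: expgz_in.
have xr : B' ((expgz g r)^-1 * (x / expgz a t)).
  have qE : expgz g q = expgz g r * expgz g (m * t)%R.
    by rewrite -expgzD rE addrC mulrC -divz_eq.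
  have -> : (expgz g r)^-1 * (x / expgz a t) = ((expgz g q)^-1 * x *
      ((expgz g (m * t)%R)^-1 * expgz a t)^-1) ^ (expgz g (m * t)%R)^-1.
    by rewrite /conjg qE !invgM !invgK !mulgA mulgV mul1g mulgK.
  apply: nB; last by apply: subgroupV => //; exact: expgz_in.
  by apply: subgroupM => //; exact: subgroupV.
have [Ay By] : A (y r) /\ B' ((expgz g r)^-1 * y r).
  apply: (@xgetPex _ 1 [set x | A x /\ B' ((expgz g r)^-1 * x)]).
  by exists (x / expgz a t); split=> //; apply: sA.2 => //; exact: AA.
have [|u uT [A'u _]] := TP ((y r)^-1 * (x / expgz a t)).
  split; first by apply: subgroupM; [| exact: subgroupV|apply: sA.2 => //; exact: AA].
  have -> : (y r)^-1 * (x / expgz a t) =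
      ((expgz g r)^-1 * y r)^-1 * ((expgz g r)^-1 * (x / expgz a t)).
    by rewrite invgM invgK -!mulgA mulVKg.
  by apply: subgroupM => //; exact: subgroupV.
exists (y r * u).
  by apply: allpairs_f => //; rewrite mem_iota /= add0n -ltz_nat rE ltz_mod.
have -> : (y r * u)^-1 * x = u^-1 * ((y r)^-1 * (x / expgz a t)) * expgz a t.
  by rewrite invgM -!mulgA mulVg mulg1.
exact: subgroupM.
Qed.

(** Along the series of A the weight taken from B drops strictly at each infinite step, so h is at
    most the weight of A, hence at most that of B, which is h'. *)
Lemma hirsch_le A B h h' : hirsch A h -> hirsch B h' -> A `<=` B -> (h <= h')%N.
Proof.
move=> HA HB AB; have sA := hirsch_subgroup HA; have sB := hirsch_subgroup HB.
have [k <- kP] := hirsch_weight HB.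
suff : (h <= k A)%N.
  by move=> /leq_trans; apply; exact: (kP B A sB sA AB (@subset_refl _ B)).1.
elim: HA AB {sA} => {A h} // A A' g h sA HA' IH [AA _ _ _] AB.
have [le1 lt1] := kP A A' sA (hirsch_subgroup HA') AA AB.
have {}IH := IH (subset_trans AA AB).
case: asboolP => [nf|_]; last by rewrite add0n (leq_trans IH).
rewrite add1n; apply: leq_ltn_trans IH _; rewrite ltnNge.
by apply/negP => /lt1.
Qed.

Lemma hirsch_inj A h h' : hirsch A h -> hirsch A h' -> h = h'.
Proof.
by move=> H H'; apply/eqP; rewrite eqn_leq (hirsch_le H H')// (hirsch_le H' H).
Qed.

Lemma cyclic_cosets A A' (g : K) : is_subgroup A -> is_subgroup A' ->
  A' `<=` A -> A g ->
  cosets A A' = cosets (range (expgz g)) A' <->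
  forall x, A x -> exists m, A' ((expgz g m)^-1 * x).
Proof.
move=> sA sA' AA Ag; split=> [E x Ax|H].
  have : cosets A A' [set x * y | y in A'] by exists x.
  rewrite E => -[_ [m _ <-] mE]; exists m.
  have : [set x * y | y in A'] x by exists 1; [exact: sA'.1|rewrite mulg1].
  by rewrite -mE => -[z A'z <-]; rewrite mulKg.
have cosetE x y : A' (y^-1 * x) ->
    [set x * z | z in A'] = [set y * z | z in A'].
  move=> Nyx; apply/seteqP; split=> _ [z Nz <-].
    exists (y^-1 * x * z); first exact: subgroupM.
    by rewrite -!mulgA mulVKg.
  exists ((y^-1 * x)^-1 * z); first by apply: subgroupM => //; exact: subgroupV.
  by rewrite invgM invgK -!mulgA mulVKg.
apply/seteqP; split=> _ [x Hx <-].
  have [m mx] := H x Hx; exists (expgz g m); first by exists m.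
  exact/esym/cosetE.
by case: Hx => m _ <-; exists (expgz g m) => //; exact: expgz_in.
Qed.

Lemma polycyclic_hirsch n (H : nat -> set K) : polycyclic_series n H ->
  hirsch setT #|[pred i : 'I_n | `[< infinite_set (cosets (H i) (H i.+1)) >]]|.
Proof.
move=> [H0 Hn sH HS].
pose b i := `[< infinite_set (cosets (H i) (H i.+1)) >].
have bE : #|[pred i : 'I_n | `[< infinite_set (cosets (H i) (H i.+1)) >]]| =
    (\sum_(0 <= i < n) b i)%N.
  by rewrite -sum1_card big_mkcond big_mkord; apply: eq_bigr => i _; rewrite inE -/(b i); case: (b i).
rewrite bE -H0; suff P j : (j <= n)%N -> hirsch (H (n - j)%N) (\sum_(n - j <= i < n) b i)%N.
  by have := P n (leqnn n); rewrite subnn.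
elim: j => [|j IH] jn; first by rewrite subn0 big_geq// Hn; exact: hirsch1.
have nj : (n - j.+1 < n)%N by lia.
have E : (n - j.+1).+1 = (n - j)%N by lia.
rewrite big_ltn// E.
have [HH nH [g Hg gE]] := HS _ nj.
have [s1 s2] : is_subgroup (H (n - j.+1)%N) /\ is_subgroup (H (n - j.+1).+1).
  by split; apply: sH; lia.
have -> : b (n - j.+1)%N = `[< ~ finite_index (H (n - j.+1)%N) (H (n - j)%N) >].
  apply: asbool_equiv_eq; rewrite E.
  by split=> H1 H2; apply: H1; apply/finite_cosets => //; rewrite -?E.
apply: (hirschS (g := g)) => //; first exact/IH/ltnW.
rewrite -E; split=> //; exact/cyclic_cosets.
Qed.

Lemma hirsch_polycyclic A h : hirsch A h -> exists n (H : nat -> set K),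
  [/\ H 0%N = A, H n = [set 1], forall i, (i <= n)%N -> is_subgroup (H i),
      forall i, (i < n)%N -> exists g, cyclic_step (H i) (H i.+1) g
    & h = #|[pred i : 'I_n | `[< infinite_set (cosets (H i) (H i.+1)) >]]|].
Proof.
elim=> {A h} [|A A' g h sA HA' [n [H [H0 Hn sH HS hE]]] st].
  exists 0%N, (fun=> [set 1]); split=> // [i _|].
    by split=> // x y -> ->; rewrite divg1.
  by rewrite eq_card0// => -[].
exists n.+1, (fun i => if i is j.+1 then H j else A); split=> //.
- by case=> // i /sH.
- by case=> [_|i iN]; [exists g; rewrite H0|exact: HS].
have cE p (B : nat -> set K) :
    #|[pred i : 'I_p | `[< infinite_set (cosets (B i) (B i.+1)) >]]| =
    (\sum_(i < p) `[< infinite_set (cosets (B i) (B i.+1)) >])%N.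
  by rewrite -sum1_card big_mkcond; apply: eq_bigr => i _; rewrite inE; case: asboolP.
rewrite hE cE (cE n.+1 (fun i => if i is j.+1 then H j else A)) big_ord_recl /=; congr (_ + _)%N; rewrite H0; congr nat_of_bool.
have sA' := hirsch_subgroup HA'.
apply: asbool_equiv_eq; split=> H1 H2; apply: H1; exact/finite_cosets.
Qed.

(** [xget] selects the count of some series; by [hirsch_inj] all series have the same count. *)
Lemma hirsch_lengthE h : hirsch setT h -> hirsch_length K = h.
Proof.
move=> Hh; apply: xget_unique; last first.
  by move=> h' [n [H [/polycyclic_hirsch HH ->]]]; exact: hirsch_inj Hh.
have [n [H [H0 Hn sH HS hE]]] := hirsch_polycyclic Hh.
exists n, H; split=> //; split=> // i iN; have [g [HH nH Hg cH]] := HS _ iN.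
by split=> //; exists g => //; apply/cyclic_cosets => //; apply: sH => //; exact: ltnW.
Qed.

End HirschLength.

(** * Hirsch length computed from a lower central base *)

Section LowerCentralHirsch.
Variables (K : groupType) (c : nat) (S : nat -> seq K).
Hypothesis Kc : gamma K c.+1 = [set 1].
Hypothesis S_base : forall i, (0 < i <= c)%N ->
  {in S i, forall y, gamma K i y} /\
  basis (lc_factor K i) [seq coset _ y | y <- S i].

(** The elements of [S j] are adjoined to [gamma K j.+1] one at a time, starting from the last. Each
    step is cyclic because they are central modulo [gamma K j.+1], and by independence it is
    infinite exactly when the new element has infinite order there. *)
Lemma hirsch_level j h : (0 < j <= c)%N -> hirsch (gamma K j.+1) h ->
  hirsch (gamma K j) (count (fun y => omega j y == 0%N) (S j) + h).
Proof.
move=> jc H1; have [memS bS] := S_base jc; have j0 : (0 < j)%N by case/andP: jc.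
set Q := quotient (gammaN K j.+1); pose pi : K -> Q := coset _.
have piM : {morph pi : x y / x * y} by exact: cosetM.
pose A t : set K := [set x | exists2 z, size z = size t & pi x = powprod [seq pi y | y <- t] z].
have AT : A (S j) = gamma K j.
  apply/seteqP; split=> x.
    move=> [z sz]; rewrite /pi => xE.
    have : lc_factor K j (coset _ x) by rewrite xE; apply: (basis_sub bS); rewrite size_map.
    move=> [y Gy /coset_eqP Gyx]; rewrite -(mulVKg y x).
    by apply: (subgroupM (gamma_subgroup _ _)) => //; exact: gammaS.
  move=> Gx; have [|z] := basis_gen bS (x := pi x); first by exists x.
  by rewrite size_map => sz xE; exists z.
rewrite -AT; suff P s t : S j = s ++ t ->
    hirsch (A t) (count (fun y => omega j y == 0%N) t + h).
  exact: (P [::]).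
elim: t s => [|x t IH] s sE.
  rewrite add0n; have -> : A [::] = gamma K j.+1 => //.
  apply/seteqP; split=> x; first by move=> [z _]; rewrite powprod_nil => /coset1P.
  by move=> Gx; exists [::] => //; rewrite powprod_nil; exact/coset1P.
have {}IH : hirsch (A t) (count (fun y => omega j y == 0%N) t + h).
  by apply: (IH (rcons s x)); rewrite cat_rcons.
have subS : {subset x :: t <= S j} by move=> y yt; rewrite sE mem_cat yt orbT.
have central y (u : Q) : y \in x :: t -> commute (pi y) u.
  by move=> /subS/memS; exact: coset_central.
have commt : commuting [seq pi y | y <- x :: t].
  by move=> _ u /mapP[y yt ->] _; exact: central.
have sA t' : {subset t' <= x :: t} -> is_subgroup (A t').
  move=> tt; split.
    exists (nseq (size t') 0%R); first by rewrite size_nseq.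
    by rewrite powprod_nseq0 (morphg1 piM).
  have commt' : commuting [seq pi y | y <- t'].
    by move=> _ u /mapP[y yt ->] _; exact/central/tt.
  move=> y y' [z sz yE] [z' sz' yE'].
  exists [seq (p.1 + p.2)%R | p <- zip z [seq (-1 * a)%R | a <- z']].
    by rewrite size_map size_zip size_map sz sz' minnn.
  by rewrite powprod_add ?size_map// powprod_scale// piM (morphgV piM) yE yE'.
have stx : cyclic_step (A (x :: t)) (A t) x.
  split.
  - move=> y [z sz yE]; exists (0%R :: z); first by rewrite /= sz.
    by rewrite yE /= powprod_cons mul1g.
  - move=> y y' [z sz yE] _; exists z => //.
    have : commute (pi y') (pi y).
      rewrite yE; apply: powprod_commute => _ /mapP[u ut ->].
      by apply/commute_sym/central; rewrite inE ut orbT.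
    by rewrite /conjg !piM (morphgV piM) => <-; rewrite mulKg.
  - exists (1%R :: nseq (size t) 0%R); first by rewrite /= size_nseq.
    by rewrite /= powprod_cons powprod_nseq0 mulg1.
  - move=> y [[|m z] //= [sz] yE]; exists m; exists z => //.
    by rewrite piM (morphgV piM) (morphgz piM) yE powprod_cons mulKg.
have -> : (count (fun y => omega j y == 0%N) (x :: t) + h)%N =
    (`[< ~ finite_index (A (x :: t)) (A t) >] + (count (fun y => omega j y == 0%N) t + h))%N.
  rewrite /= addnA; congr (_ + _ + _)%N; congr nat_of_bool.
  apply/eqP/asboolP => [w0 [r rP]|nf]; last first.
    apply/eqP; rewrite -leqn0 leqNgt; apply/negP => w0; apply: nf.
    exists [seq expgz x (Posz i) | i <- iota 0 (omega j x)] => y [[|m z] //= [sz] yE].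
    have w0' : Posz (omega j x) != 0%R by lia.
    exists (expgz x (absz (m %% omega j x)%Z)).
      apply: map_f; rewrite mem_iota /= add0n -ltz_nat gez0_abs ?modz_ge0//.
      by rewrite ltz_pmod//; lia.
    exists z => //; rewrite piM (morphgV piM) (morphgz piM) yE powprod_cons.
    rewrite gez0_abs ?modz_ge0//.
    have -> : expgz (pi x) m = expgz (pi x) (m %% omega j x)%Z.
      transitivity (expgz (pi x) (Posz (omega j x) * (m %/ omega j x)%Z + (m %% omega j x)%Z)%R).
        by rewrite mulrC -divz_eq.
      move: (m %% omega j x)%Z (m %/ omega j x)%Z => r q; rewrite expgzD expgzM.
      have -> : expgz (pi x) (omega j x) = 1 by apply/elt_orderP; rewrite /= dvdnn.
      by rewrite expg1z mul1g.
    by rewrite mulKg.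
  have xX (i : nat) : A (x :: t) (expgz x i).
    by apply: expgz_in; [exact: sA|have [] := stx].
  have /choice[f fP] : forall i : nat, exists y, y \in r /\ A t (y^-1 * expgz x i).
    by move=> i; have [y yr Ay] := rP _ (xX i); exists y.
  (* [f i] represents the coset of the i-th power of x. If [f i = f i'], a relation arises with
     exponent [i' - i] at x, padded with zeros on s to fit [bS]; infinite order forces [i = i'].
     Then r would contain more elements than its size. *)
  have inj : injective f.
    move=> i i' ii; apply/eqP/negPn/negP => ne.
    have At : A t ((expgz x i)^-1 * expgz x i').
      have -> : (expgz x i)^-1 * expgz x i' =
          ((f i)^-1 * expgz x i)^-1 * ((f i')^-1 * expgz x i').
        by rewrite ii invgM invgK -!mulgA mulVKg.
      have sAt : is_subgroup (A t) by apply: sA => y; rewrite inE orbC => ->.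
      apply: subgroupM => //; last exact: (fP i').2.
      by apply: subgroupV => //; exact: (fP i).2.
    have [z sz] := At; rewrite piM (morphgV piM) !(morphgz piM) -expgzN -expgzD => E.
    have := basis_indep bS (z := nseq (size s) 0%R ++
       (- Posz i + Posz i')%R :: [seq (-1 * a)%R | a <- z]).
    rewrite sE size_cat /= !size_map size_cat /= size_nseq sz => /(_ erefl).
    rewrite map_cat powprod_cat ?size_nseq ?size_map// powprod_nseq0 mul1g powprod_cons -/(pi x) E.
    rewrite powprod_scale; last by have [] := commuting_cons commt.
    rewrite mulgV => /(_ erefl).
    rewrite zip_cat ?size_nseq ?size_map// all_cat /= => /and3P[_ + _].
    by rewrite -[elt_order _]/(omega j x) w0 dvd0n; lia.
  have : (size [seq f i | i <- iota 0 (size r).+1] <= size r)%N.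
    apply: uniq_leq_size; first by rewrite map_inj_uniq ?iota_uniq.
    by move=> _ /mapP[i _ ->]; exact: (fP i).1.
  by rewrite size_map size_iota ltnn.
by apply: hirschS stx; [exact: sA|exact: IH].
Qed.

Lemma hirsch_length_levels :
  hirsch_length K = count (fun w => w == 0%N) (unzip2 (levels S 1 c)).
Proof.
apply: hirsch_lengthE.
suff P n j : (0 < j)%N -> (j + n = c.+1)%N ->
    hirsch (gamma K j) (count (fun w => w == 0%N) (unzip2 (levels S j n))).
  by apply: (P c 1%N).
elim: n j => [|n IH] j j0 jn.
  by move: jn; rewrite addn0 => ->; rewrite Kc; exact: hirsch1.
rewrite (levelsS S j n).2 count_cat count_map.
apply: hirsch_level; first by lia.
by apply: IH => //; lia.
Qed.

End LowerCentralHirsch.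

(** * The base of the group of equations *)

Lemma varsP (G : groupType) c k (x : eqn_group G c k) :
  x \in vars G c k -> exists j, x = eqn_var G c j.
Proof.
by move=> /mapP[j _ ->]; exists j.
Qed.

Lemma size_vars (G : groupType) c k : size (vars G c k) = k.
Proof.
by rewrite size_map size_enum_ord.
Qed.

Lemma map_vars (G : groupType) c k (T : Type) (f : eqn_group G c k -> T) :
  [seq f x | x <- vars G c k] = [seq f (eqn_var G c j) | j <- enum 'I_k].
Proof.
by rewrite -map_comp.
Qed.

Lemma map_cat_assoc (T T' : Type) (s s' t : seq T) (f g : T -> T') r :
  s' = s -> [seq f x | x <- s] = [seq g x | x <- s] ->
  [seq f x | x <- s] ++ [seq g x | x <- t] ++ r = [seq g x | x <- s' ++ t] ++ r.
Proof.
by move=> -> ->; rewrite map_cat catA.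
Qed.

Lemma omegaE (G : groupType) i (y : G) :
  omega i y = elt_order (coset (gammaN G i.+1) y).
Proof.
by [].
Qed.

#[local] Opaque eqn_group vars omega elt_order.

(* Sending the variables to 1 in this group shows that they have infinite order. *)
Definition int_group : Type := int.
HB.instance Definition _ := Choice.on int_group.
HB.instance Definition _ := isGroup.Build int_group
  (@addrA int) (@add0r int) (@addr0 int) (@addNr int) (@addrN int).

Lemma expgz_int_group (m : int) : expgz (1%R : int_group) m = m.
Proof.
have X n : (1%R : int_group) ^+ n = Posz n.
  elim: n => // n IH; rewrite expgS IH.
  by rewrite -[LHS]/(1 + Posz n)%R; lia.
case: m => n; rewrite /= X//.
Qed.

Lemma gamma2_le (G : groupType) (A : set G) : is_subgroup A ->
  (forall x y, A [~ x, y]) -> forall x, gamma G 2 x -> A x.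
Proof.
by move=> sA AR x Gx; apply: (Gx A) => // _ [u [v [_ _ ->]]].
Qed.

Lemma gamma_int_group c : (0 < c)%N -> gamma int_group c.+1 = [set 1].
Proof.
case: c => // c _; apply/seteqP; split=> x /=; last first.
  by move=> ->; exact: (gamma_subgroup _ _).1.
move=> /(@gamma_le _ 2 c.+2 x isT); apply: (@gamma2_le _ [set 1]) => [|u v].
  by split=> // y z -> ->; rewrite divg1.
by apply/eqP/commgP; exact: (@addrC int u v).
Qed.

Section EquationBase.
Variables (G : groupType) (c k : nat).
Hypothesis c_gt0 : (0 < c)%N.
Hypothesis Gc : gamma G c.+1 = [set 1].
Local Notation GX := (eqn_group G c k).
Local Notation const := (@eqn_const G c k).
Local Notation var := (@eqn_var G c k).
Variables (d : nat -> seq G) (b : nat -> seq GX).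
Hypothesis d_base : lower_central_base c d.
Hypothesis b_base : complement_base b.

Lemma retraction_exists (h : 'I_k -> G) : exists phi : {multiplicative GX -> G},
  (forall g, phi (const g) = g) /\ (forall j, phi (var j) = h j).
Proof.
exact: (eqn_group_lift (f := id)).
Qed.

Lemma d_basis i : (0 < i <= c)%N -> {in d i, forall y, gamma G i y} /\
  basis (lc_factor G i) [seq coset _ y | y <- d i].
Proof.
by move=> /d_base[dG dB]; split=> //; exact: is_base_basis.
Qed.

(** Injectivity comes from the retraction onto G that sends the variables to 1: it maps
    [gamma GX i.+1] into [gamma G i.+1] and fixes the constants. *)
Lemma const_factor i : exists f : quotient (gammaN G i.+1) -> quotient (gammaN GX i.+1),
  [/\ {morph f : x y / x * y}, forall x, f x = 1 -> x = 1
    & forall g, f (coset _ g) = coset _ (const g)].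
Proof.
have [||f fM fE] := quotient_lift (N := gammaN G i.+1)
    (f := fun g => coset (gammaN GX i.+1) (const g)).
- by move=> x y; rewrite eqn_constM cosetM.
- move=> x Gx; apply/coset1P; exact: (morph_gamma (@eqn_constM _ _ _)).
exists f; split=> // u; rewrite -[u]coset_repr fE => /coset1P Gu; apply/coset1P.
have [phi [phiC _]] := retraction_exists (fun=> 1).
by rewrite -[repr u]phiC; apply: morph_gamma Gu; exact: gmulfM.
Qed.

Lemma omega_const i y : omega i (const y) = omega i y.
Proof.
have [f [fM fI fE]] := const_factor i.
by rewrite !omegaE -fE (morph_elt_order _ fM fI).
Qed.

Lemma omega_var j : omega 1 (var j) = 0%N.
Proof.
have [psi [_ psiV]] := eqn_group_lift (f := fun _ : G => 1) (fun _ : 'I_k => 1%R : int_group)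
  (gamma_int_group c_gt0) (fun _ _ => esym (mulg1 1)).
have : expgz (coset (gammaN GX 2) (var j)) (omega 1 (var j)) = 1.
  by apply/elt_orderP; rewrite /= dvdnn.
rewrite -(morphgz (@cosetM _ _)) => /coset1P /(morph_gamma (@gmulfM _ _ psi)).
rewrite (morphgz (@gmulfM _ _ psi)) psiV expgz_int_group.
by rewrite (@gamma_int_group 1%N) => // -[].
Qed.

Definition level_base i := b i ++ [seq const y | y <- d i].

Lemma level_baseP i : (0 < i <= c)%N -> {in level_base i, forall y, gamma GX i y} /\
  basis (lc_factor GX i) [seq coset _ y | y <- level_base i].
Proof.
move=> ic; have [_ /(_ i ic)[B [dp bG bB]]] := b_base.
have [dG dB] := d_basis ic; split.
  move=> y; rewrite mem_cat => /orP[/bG//|/mapP[x xd ->]].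
  by apply: (morph_gamma (@eqn_constM _ _ _)); exact: dG.
have [f [fM fI fE]] := const_factor i.
rewrite (map_cat _ (b i)); apply: basis_cat dp _ (is_base_basis bB).
have := basis_image fM fI dB.
have -> : f @` lc_factor G i = [set coset _ (const g) | g in gamma G i].
  apply/seteqP; split=> [_ [_ [g Gg <-] <-]|_ [g Gg <-]].
    by exists g => //; rewrite fE.
  by exists (coset _ g); [exists g|rewrite fE].
rewrite -!map_comp; congr basis; apply: eq_map => y /=; exact: fE.
Qed.

(** The bound 0 recorded at the variables is their actual order, and they form [b 1]; so the base is
    a union of level bases, to which existence and uniqueness of normal forms apply. The
    decomposition in [eqn_base_coef] sets the variables apart for counting. *)
Lemma eqn_base_levels : eqn_base d b = levels level_base 1 c.
Proof.
have [b1 _] := b_base; rewrite /eqn_base -[X in levels _ _ X](prednK c_gt0) levels_cons.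
have vE : [seq (x, 0%N) | x <- vars G c k] = [seq (y, omega 1 y) | y <- vars G c k].
  by apply/eq_in_map => x /varsP[j ->]; rewrite omega_var.
exact: (@map_cat_assoc _ _ (vars G c k) (b 1) (map const (d 1)) _ _ _ b1 vE).
Qed.

(* The variables are the block [b 1] of the base; they are treated apart. *)
Definition new_base i := if i == 1%N then [::] else b i.
Definition coef_base i := new_base i ++ [seq const y | y <- d i].

Lemma eqn_base_coef :
  eqn_base d b = [seq (x, 0%N) | x <- vars G c k] ++ levels coef_base 1 c.
Proof.
rewrite /eqn_base -[X in levels _ _ X](prednK c_gt0) levels_cons.
congr (_ ++ (_ ++ flatten _)).
apply/eq_in_map => i; rewrite mem_iota => /andP[i2 _].
by rewrite /coef_base /new_base; case: eqP i2 => // ->.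
Qed.

Lemma unzip1_eqn_base : unzip1 (eqn_base d b) =
  vars G c k ++ unzip1 (levels coef_base 1 c).
Proof.
rewrite eqn_base_coef /unzip1 (map_cat _ (map _ (vars G c k))) -(map_comp _ _ (vars G c k)).
by rewrite (map_id (vars G c k)).
Qed.

Lemma unzip2_eqn_base : unzip2 (eqn_base d b) =
  nseq k 0%N ++ unzip2 (levels coef_base 1 c).
Proof.
rewrite eqn_base_coef /unzip2 (map_cat _ (map _ (vars G c k))); congr (_ ++ _).
rewrite -[in RHS](size_vars G c k) -(map_comp _ _ (vars G c k)).
by elim: (vars G c k) => //= x s ->.
Qed.

Lemma rho_eqn_base (R : realType) (A : set GX) n : rho (eqn_base d b) R A n =
  ((count (fun z => `[< A (powprod (unzip1 (eqn_base d b)) z) >])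
      (box (unzip2 (eqn_base d b)) n))%:R /
   (size (box (unzip2 (eqn_base d b)) n))%:R)%R.
Proof.
apply: rhoE; rewrite eqn_base_levels.
  move=> u; apply: (@levels_exists GX c) => //.
  - exact: eqn_group_gamma.
  - exact: level_baseP.
move=> z z'; apply: (@levels_unique GX c) => //.
exact: level_baseP.
Qed.

Lemma new_base_gamma i : (0 < i <= c)%N ->
  {in new_base i, forall y, gamma GX i y /\ gamma GX 2 y}.
Proof.
move=> ic y; rewrite /new_base; case: eqP => // i1 yb.
have Gy : gamma GX i y by apply: (level_baseP ic).1; rewrite mem_cat yb.
by split=> //; apply: gamma_le Gy; lia.
Qed.

(* Changing the values of the variables by elements of [gamma G i] changes the
   values of a homomorphism modulo [gamma G i.+1] by a homomorphism. *)
Lemma retraction_quotient i (phi phi' : {multiplicative GX -> G}) : (0 < i)%N ->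
  (forall g, phi (const g) = phi' (const g)) ->
  (forall j, gamma G i ((phi (var j))^-1 * phi' (var j))) ->
  let theta u := coset (gammaN G i.+1) ((phi u)^-1 * phi' u) in
  [/\ {morph theta : u v / u * v}, forall g, theta (const g) = 1
    & forall u, gamma GX 2 u -> theta u = 1].
Proof.
move=> i0 phiC phiV theta.
have phiM := @gmulfM _ _ phi; have phi'M := @gmulfM _ _ phi'.
have [sG nG] := gamma_normal G i.
have Gu u : gamma G i ((phi u)^-1 * phi' u).
  apply: (@eqn_group_ind G c k [set u | gamma G i ((phi u)^-1 * phi' u)]) => //.
    split; first by rewrite /= (morphg1 phiM) (morphg1 phi'M) mulVg; exact: sG.1.
    move=> x y /= Gx Gy; rewrite phiM phi'M (morphgV phiM) (morphgV phi'M).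
    have -> : (phi x / phi y)^-1 * (phi' x / phi' y) =
      (((phi x)^-1 * phi' x) * ((phi y)^-1 * phi' y)^-1) ^ (phi y)^-1.
      by rewrite /conjg !invgM !invgK !mulgA mulgK.
    by apply: nG; exact: sG.2.
  by move=> g /=; rewrite phiC mulVg; exact: sG.1.
have thetaM : {morph theta : u v / u * v}.
  move=> u v; rewrite /theta phiM phi'M.
  have -> : (phi u * phi v)^-1 * (phi' u * phi' v) =
      (phi v)^-1 * (((phi u)^-1 * phi' u) * phi' v) by rewrite invgM !mulgA.
  rewrite !cosetM.
  have := @coset_central _ i _ (coset _ (phi v)^-1) i0 (Gu u).
  by rewrite /commute !cosetM => E; rewrite mulgA -E !mulgA.
have thetaC g : theta (const g) = 1.
  by rewrite /theta phiC mulVg (morphg1 (@cosetM _ _)).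
have sK : is_subgroup (theta @^-1` [set 1]).
  by apply: preim_subgroup => //; split=> // x y -> ->; rewrite divg1.
split=> //; apply: (gamma2_le sK) => x y /=.
rewrite (morphg_comm thetaM); apply/eqP/commgP.
exact: coset_central.
Qed.

End EquationBase.

(** * Upper bound *)

(** A coordinate of finite order is unrestricted and cancels; one of infinite order keeps the
    proportion r. *)
Lemma prod_size_ratio (R : realType) (T : Type) (w : T -> nat) (F : T -> nat) n (r : R) (s : seq T) :
  (forall x, w x != 0%N -> F x = size (exp_range (w x) n)) ->
  (forall x, w x = 0%N -> (F x)%:R / (n.*2.+1)%:R = r)%R ->
  ((\prod_(x <- s) F x)%N%:R / (\prod_(x <- s) size (exp_range (w x) n))%N%:R
    = r ^+ count (fun x => w x == 0%N) s)%R.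
Proof.
move=> F1 F0; elim: s => [|x s IH]; first by rewrite !big_nil divr1 expr0.
rewrite !big_cons !natrM invfM mulrACA IH /=; have [w0|w0] := eqVneq (w x) 0%N.
  by rewrite w0 size_exp_range0 F0// exprS.
by rewrite F1// divff ?mul1r// pnatr_eq0 -lt0n size_exp_range_gt0.
Qed.

Section Solvability.
Variables (G : groupType) (c k : nat).
Hypothesis c_gt0 : (0 < c)%N.
Hypothesis Gc : gamma G c.+1 = [set 1].
Local Notation GX := (eqn_group G c k).
Local Notation const := (@eqn_const G c k).
Local Notation var := (@eqn_var G c k).
Variables (d : nat -> seq G) (b : nat -> seq GX).
Hypothesis d_base : lower_central_base c d.
Hypothesis b_base : complement_base b.
Local Notation coefs := (levels (coef_base d b)).
Local Notation base := (unzip1 (eqn_base d b)).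
Local Notation weights := (unzip2 (eqn_base d b)).

Let coef_bound j n : (0 < j)%N -> (j + n.+1 = c.+1)%N -> (0 < j <= c)%N.
Proof.
lia.
Qed.

Lemma coef_base_gamma i : (0 < i <= c)%N -> {in coef_base d b i, forall y, gamma GX i y}.
Proof.
move=> ic y; rewrite mem_cat => /orP[/(new_base_gamma c_gt0 Gc d_base b_base ic)[]//|yd].
by apply: (level_baseP Gc d_base b_base ic).1; rewrite mem_cat yd orbT.
Qed.

Lemma coefs_in j n z : (0 < j)%N -> (j + n = c.+1)%N ->
  gamma GX j (powprod (unzip1 (coefs j n)) z).
Proof.
move=> j0 jn; apply: powprod_in; first exact: gamma_subgroup.
elim: n j j0 jn => [|n IH] j j0 jn x //; rewrite (levelsS _ j n).1 mem_cat.
move=> /orP[/(coef_base_gamma (coef_bound j0 jn))//|xl]; apply: gammaS.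
by apply: IH xl; rewrite // addSnnS.
Qed.

Lemma coefs1E : unzip1 (coefs 1 c) =
    [seq const y | y <- d 1] ++ unzip1 (coefs 2 c.-1) /\
  unzip2 (coefs 1 c) = [seq omega 1 y | y <- d 1] ++ unzip2 (coefs 2 c.-1).
Proof.
have [E1 E2] := levelsS (coef_base d b) 1 c.-1.
rewrite prednK// in E1 E2; rewrite E1 E2; split=> //; congr (_ ++ _).
rewrite /coef_base /new_base eqxx -(map_comp _ _ (d 1)).
by apply: eq_map => y; rewrite /comp (omega_const k Gc).
Qed.

Lemma sat_divides z z1 z2 : size z = k -> size z1 = size (d 1) ->
  SAT G c k (powprod base (z ++ z1 ++ z2)) ->
  all (fun q => (omega 1 q.1 == 0%N) ==> (gcds z %| `|q.2|)%N) (zip (d 1) z1).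
Proof.
move=> sz sz1 [h [phi [phiC phiV]]].
have [dG dB] := d_basis d_base (c_gt0 : (0 < 1 <= c)%N).
pose pi := coset (gammaN G 2); pose psi u := pi (phi u).
have piM : {morph pi : x y / x * y} by exact: cosetM.
have psiM : {morph psi : x y / x * y} by move=> x y; rewrite /psi gmulfM piM.
rewrite (unzip1_eqn_base c_gt0) coefs1E.1 powprod_cat ?size_vars// powprod_cat ?size_map//.
set u := _ * (_ * _) => phiu.
have : psi u = 1 by rewrite /psi phiu (morphg1 piM).
rewrite /u !psiM.
have -> : psi (powprod (unzip1 (coefs 2 c.-1)) z2) = 1.
  apply/coset1P; apply: (morph_gamma (@gmulfM _ _ phi)); apply: coefs_in => //.
  by rewrite -[in RHS](prednK c_gt0).
rewrite mulg1 !(morph_powprod _ _ psiM).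
have -> : [seq psi x | x <- [seq const y | y <- d 1]] = [seq pi y | y <- d 1].
  by rewrite -(map_comp _ _ (d 1)); apply: eq_map => y; rewrite /comp /psi phiC.
have cpsi : commuting [seq psi x | x <- vars G c k].
  by move=> _ v /mapP[x _ ->] _; exact: coset_central.
(* Modulo commutators the variables contribute a power with exponent [gcds z]. This includes the
   zero tuple, whose contribution is trivial. *)
have [z' sz' zE] := gcds_factor z; rewrite {1}zE powprod_scale//.
have : lc_factor G 1 (powprod [seq psi x | x <- vars G c k] z').
  by exists (repr (powprod [seq psi x | x <- vars G c k] z')) => //; exact: coset_repr.
move=> /(basis_gen dB)[y]; rewrite size_map => sy ->.
have cD := basis_comm dB; rewrite -powprod_scale// -powprod_add ?size_map//.
move=> /(basis_indep dB); rewrite !size_map size_zip size_map sy sz1 minnn => /(_ erefl).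
(* Each sum [gcds z * a + a1] is divisible by the order of its base element; at infinite order it
   vanishes, so [gcds z] divides a1. *)
elim: (d 1) y z1 sy sz1 {dG dB cD u phiu} => [|x s IH] [|a y] [|a1 z1] //= [sy] [sz1].
move=> /andP[xa /(IH _ _ sy sz1) ->]; rewrite andbT; apply/implyP => /eqP w0.
move: xa; rewrite -omegaE w0 dvd0n absz_eq0 addrC addr_eq0 => /eqP ->.
by rewrite abszN abszM absz_nat dvdn_mulr.
Qed.

Definition divisible_count n g := count
  (fun z => all (fun q => (omega 1 q.1 == 0%N) ==> (g %| `|q.2|)%N) (zip (d 1) z))
  (box [seq omega 1 y | y <- d 1] n).

Lemma divisible_count_le n g :
  (divisible_count n g <= size (box [seq omega 1 y | y <- d 1] n))%N.
Proof.
exact: count_size.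
Qed.

Lemma divisible_ratio (R : realType) n g : (0 < g)%N ->
  ((divisible_count n g)%:R / (size (box [seq omega 1 y | y <- d 1] n))%:R =
   multiples R n g ^+ count (fun y => omega 1 y == 0%N) (d 1))%R.
Proof.
move=> g0; rewrite /divisible_count size_box big_map.
rewrite (count_box_prod (omega 1) (fun y a => (omega 1 y == 0%N) ==> (g %| `|a|)%N)).
apply: prod_size_ratio => y w0.
  by rewrite -[RHS]count_predT; apply: eq_count => a /=; rewrite (negPf w0).
by rewrite w0 eqxx (count_dvd_range n g0).
Qed.

(** The necessary condition concerns only the variables and [d 1]; the exponents from level 2 on are
    counted in full. *)
Lemma sat_count_le n :
  (count (fun z => `[< SAT G c k (powprod base z) >]) (box weights n) <=
   (\sum_(z <- box (nseq k 0) n) divisible_count n (gcds z)) *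
     size (box (unzip2 (coefs 2 c.-1)) n))%N.
Proof.
rewrite (unzip2_eqn_base c_gt0) coefs1E.2 count_box_cat big_distrl /=.
rewrite big_seq [leqRHS]big_seq; apply: leq_sum => z.
rewrite mem_box0 => /andP[/eqP sz _]; rewrite count_box_cat /divisible_count.
rewrite -[X in (_ <= X * _)%N]sum1_count [X in (_ <= X * _)%N]big_mkcond big_distrl.
rewrite big_seq [leqRHS]big_seq.
apply: leq_sum => z1; rewrite mem_box size_map => /andP[/eqP sz1 _].
case: ifPn => [_|nd]; first by rewrite -[leqRHS]/(1 * _)%N mul1n count_size.
rewrite -[leqRHS]/(0 * _)%N mul0n leqNgt -has_count; apply/hasPn => z2 _.
by apply: contra nd => /asboolP; exact: sat_divides.
Qed.

Lemma rho01 (R : realType) (A : set GX) n :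
  (0 <= rho (eqn_base d b) R A n <= 1)%R.
Proof.
rewrite (rho_eqn_base c_gt0 Gc d_base b_base) divr_ge0 ?ler0n//=.
have s0 : (0 < size (box weights n))%N.
  by rewrite size_box prodn_gt0// => w; exact: size_exp_range_gt0.
by rewrite ler_pdivrMr ?ltr0n// mul1r ler_nat count_size.
Qed.

Lemma rho_sat_le (R : realType) n : (0 < k)%N ->
  (rho (eqn_base d b) R (SAT G c k) n <= gcd_freq R k n 0 +
   \sum_(0 <= i < n) gcd_freq R k n i.+1 *
     multiples R n i.+1 ^+ count (fun y => omega 1 y == 0%N) (d 1))%R.
Proof.
move=> k0; rewrite (rho_eqn_base c_gt0 Gc d_base b_base).
set s1 := size (box [seq omega 1 y | y <- d 1] n).
set s2 := size (box (unzip2 (coefs 2 c.-1)) n).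
have sE : size (box weights n) = (n.*2.+1 ^ k * s1 * s2)%N.
  rewrite (unzip2_eqn_base c_gt0) coefs1E.2 size_box !big_cat /= -!size_box.
  by rewrite size_box0 mulnA.
have pos ws : (0 < size (box ws n))%N.
  by rewrite size_box prodn_gt0// => w; exact: size_exp_range_gt0.
rewrite sE !natrM natrX ler_pdivrMr ?mulr_gt0 ?exprn_gt0 ?ltr0n ?pos//.
have := sat_count_le n; rewrite -(ler_nat R) => /le_trans; apply.
rewrite natrM mulrA ler_wpM2r ?ler0n// (sum_box_gcds _ _ k0) big_nat_recl//.
have bE g : (\sum_(z <- box (nseq k 0) n | gcds z == g) divisible_count n (gcds z) =
    gcd_count k n g * divisible_count n g)%N.
  rewrite (eq_bigr (fun=> divisible_count n g)) => [|z /eqP ->//].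
  by rewrite big_const_seq iter_addn_0 mulnC.
have s10 : (s1%:R : R)%R != 0%R by rewrite pnatr_eq0 -lt0n pos.
have n0 : ((n.*2.+1)%:R ^+ k : R)%R != 0%R by rewrite expf_neq0 ?pnatr_eq0.
rewrite natrD bE mulrDl natrM lerD//.
  have -> : (gcd_freq R k n 0 * (n.*2.+1%:R ^+ k * s1%:R) =
      (gcd_count k n 0)%:R * s1%:R)%R by rewrite /gcd_freq; field.
  by rewrite ler_wpM2l ?ler0n// ler_nat divisible_count_le.
rewrite natr_sum mulr_suml ler_sum// => i _.
rewrite bE natrM -divisible_ratio// /gcd_freq -/s1.
by rewrite le_eqVlt; apply/orP; left; apply/eqP; field; rewrite s10 n0.
Qed.

End Solvability.

(** * Lower bound *)

Lemma powprod_powers (K : groupType) (x : K) (m z : seq int) : size m = size z ->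
  powprod [seq expgz x (- a)%R | a <- m] z =
  expgz x (- \sum_(p <- zip z m) p.1 * p.2)%R.
Proof.
elim: m z => [|a m IH] [|a' z] //=; first by rewrite powprod_nil big_nil.
move=> [sm]; rewrite powprod_cons IH// big_cons /= -expgzM -expgzD; congr expgz; lia.
Qed.

Section LowerBound.
Variables (G : groupType) (c k : nat).
Hypothesis c_gt0 : (0 < c)%N.
Hypothesis Gc : gamma G c.+1 = [set 1].
Local Notation GX := (eqn_group G c k).
Local Notation const := (@eqn_const G c k).
Local Notation var := (@eqn_var G c k).
Variables (d : nat -> seq G) (b : nat -> seq GX).
Hypothesis d_base : lower_central_base c d.
Hypothesis b_base : complement_base b.
Local Notation coefs := (levels (coef_base d b)).
Local Notation base := (unzip1 (eqn_base d b)).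
Local Notation weights := (unzip2 (eqn_base d b)).

(* That is, modulo constants and commutators, [u] is the product of the
   variables with exponents [z]. *)
Definition has_exponents z (u : GX) := forall (Q : groupType) (theta : GX -> Q),
  {morph theta : x y / x * y} -> (forall g, theta (const g) = 1) ->
  (forall v, gamma GX 2 v -> theta v = 1) -> theta u = theta (powprod (vars G c k) z).

Lemma has_exponents_const z u g : has_exponents z u -> has_exponents z (u * const g).
Proof.
by move=> uz Q theta tM tC tG; rewrite tM tC mulg1; exact: uz.
Qed.

Lemma has_exponents_gamma z u v : gamma GX 2 v ->
  has_exponents z u -> has_exponents z (u * v).
Proof.
by move=> Gv uz Q theta tM tC tG; rewrite tM (tG _ Gv) mulg1; exact: uz.
Qed.

(** A partial solution; at [i = c.+1] it is a solution, since [gamma G c.+1] is trivial. *)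
Definition level_solution i (u : GX) := exists phi : {multiplicative GX -> G},
  (forall g, phi (const g) = g) /\ gamma G i (phi u).

(* If [y ^ g] is the value of [u], where [g] is the sum of the [m_j * z_j],
   multiply the value of the j-th variable by [y ^ - m_j]. *)
Lemma level_solutionS i z u (y : G) : (0 < i)%N -> size z = k ->
  has_exponents z u -> gamma G i y ->
  (exists phi : {multiplicative GX -> G}, (forall g, phi (const g) = g) /\
     coset (gammaN G i.+1) (phi u) = coset _ (expgz y (gcds z))) ->
  level_solution i.+1 u.
Proof.
move=> i0 sz uz Gy [phi [phiC phiu]].
have [m sm mE] := gcds_bezout z.
have [phi' [phi'C phi'V]] := retraction_exists (k := k) Gc
  (fun j => phi (var j) * expgz y (- nth 0%R m j)%R).
exists phi'; split=> //; apply/(coset1P (gammaN G i.+1)).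
have VE j : (phi (var j))^-1 * phi' (var j) = expgz y (- nth 0%R m j)%R.
  by rewrite phi'V mulKg.
have [|j|] := @retraction_quotient G c k i phi phi' i0.
- by move=> g; rewrite phiC phi'C.
- by rewrite VE; apply: expgz_in => //; exact: gamma_subgroup.
set theta := fun u => _ => tM tC tG.
(* The correction is [theta u]. By [uz] it is the product of the images of the variables with
   exponents z, that is, y to the power minus the sum of the [m_j * z_j], which cancels [y ^ g]. *)
have -> : phi' u = phi u * ((phi u)^-1 * phi' u) by rewrite mulVKg.
rewrite cosetM phiu -/(theta u) (uz _ theta)// (morph_powprod _ _ tM) map_vars.
have -> : [seq theta (var j) | j <- enum 'I_k] =
    [seq expgz (coset (gammaN G i.+1) y) (- a)%R | a <- m].
  have mjE : [seq nth 0%R m (val j) | j <- enum 'I_k] = m.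
    rewrite (map_comp (nth 0%R m) val) val_enum_ord.
    by rewrite -/(mkseq _ _) -sz -sm mkseq_nth.
  rewrite -[X in _ = map _ X]mjE -[RHS]map_comp; apply: eq_map => j.
  by rewrite /theta VE (morphgz (@cosetM _ _)).
rewrite powprod_powers ?sm// mE -(morphgz (@cosetM _ _)) -cosetM -expgzD subrr.
exact: (morphg1 (@cosetM _ _)).
Qed.

Definition congruent_exponents i (g : nat) (t z1 : seq int) :=
  all (fun q => if omega i q.1.1 == 0%N then (g %| (q.2 - q.1.2)%R)%Z
                else q.2 == q.1.2) (zip (zip (d i) t) z1).

(** A lower bound for the number of good exponents at one level: those of [new_base] are free, an
    element of infinite order in [d i] has a residue class modulo g, and one of finite order a
    single value. *)
Definition level_bound n g i : nat :=
  size (box [seq omega i y | y <- new_base b i] n) *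
  (n.*2.+1 %/ g) ^ count (fun y => omega i y == 0%N) (d i).

Lemma level_step i z u z0 : (0 < i <= c)%N -> size z = k ->
  size z0 = size (new_base b i) ->
  has_exponents z u -> level_solution i u ->
  exists2 t, reduced [seq omega i y | y <- d i] t &
  forall z1, size z1 = size (d i) -> congruent_exponents i (gcds z) t z1 ->
    let v := u * powprod (coef_base d b i) (z0 ++ z1) in
    has_exponents z v /\ level_solution i.+1 v.
Proof.
move=> ic sz sz0 uz [phi [phiC phiu]]; have i0 : (0 < i)%N by case/andP: ic.
have [dG dB] := d_basis d_base ic.
set u1 := u * powprod (new_base b i) z0.
have bG := new_base_gamma c_gt0 Gc d_base b_base ic.
have u1z : has_exponents z u1.
  apply: has_exponents_gamma => //; apply: powprod_in; first exact: gamma_subgroup.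
  by move=> y /bG[].
have u1G : gamma G i (phi u1).
  rewrite gmulfM; apply: subgroupM => //; first exact: gamma_subgroup.
  apply: (morph_gamma (@gmulfM _ _ phi)); apply: powprod_in; first exact: gamma_subgroup.
  by move=> y /bG[].
pose pi := coset (gammaN G i.+1); pose D := [seq pi y | y <- d i].
have piM : {morph pi : x y / x * y} by exact: cosetM.
(* The class to aim at consists of the coordinates of the inverse of the current value: exponents
   congruent to them modulo [gcds z] cancel that value up to a power with exponent [gcds z]. *)
have [|t0] := basis_gen dB (x := pi (phi u1)^-1).
  by exists (phi u1)^-1 => //; apply: subgroupV => //; exact: gamma_subgroup.
move=> /reduced_exists[t rt <-] tE; exists t.
  by move: rt; rewrite -map_comp; congr reduced; apply: eq_map => y; rewrite /comp omegaE.
have st : size t = size (d i) by rewrite (reduced_size rt) !size_map.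
move=> z1 sz1 tz1 v.
have vE : v = u1 * const (powprod (d i) z1).
  rewrite /v /coef_base powprod_cat// mulgA; congr (_ * _).
  exact/esym/morph_powprod/eqn_constM.
have vz : has_exponents z v by rewrite vE; exact: has_exponents_const.
split=> //.
have [y sy z1E] : exists2 y, size y = size (d i) & powprod D z1 =
    powprod D [seq (p.1 + p.2)%R | p <- zip t [seq ((gcds z)%:Z * a)%R | a <- y]].
  move: tz1; rewrite /congruent_exponents => tz1.
  elim: (d i) t z1 st sz1 tz1 @D {dG dB rt tE v vE vz} => [|x s IH] [|a t] [|a1 z1] //=.
    by exists [::].
  move=> [st] [sz1] /andP[xa /(IH _ _ st sz1)[y sy yE]].
  have [q qE] : exists q, (a1 = a + (gcds z)%:Z * q)%R.
    move: xa; case: eqP => _ => [/dvdzP[q qE]|/eqP ->]; last by exists 0%R; lia.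
    by exists q; rewrite mulrC -qE addrC subrK.
  by exists (q :: y); rewrite /= ?sy// !powprod_cons yE qE.
have cD := basis_comm dB.
have phiv : pi (phi v) = expgz (powprod D y) (gcds z).
  rewrite vE gmulfM phiC piM (morph_powprod _ _ piM) -/D z1E powprod_add ?size_map//.
  by rewrite powprod_scale// -tE (morphgV piM) mulVKg.
apply: (level_solutionS (z := z) (y := powprod (d i) y)) => //.
  by apply: powprod_in => //; exact: gamma_subgroup.
exists phi; split=> //; rewrite -/pi phiv (morphgz piM) (morph_powprod _ _ piM).
by [].
Qed.

(** At finite order the required exponent is at most [omega - 1], so the bound on [omega] places it
    in the box. *)
Lemma congruent_count n g i t : (0 < g)%N -> size t = size (d i) ->
  reduced [seq omega i y | y <- d i] t ->
  (forall y, y \in d i -> (omega i y <= n.+1)%N) ->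
  ((n.*2.+1 %/ g) ^ count (fun y => omega i y == 0%N) (d i) <=
   count (congruent_exponents i g t) (box [seq omega i y | y <- d i] n))%N.
Proof.
move=> g0 st rt wn; rewrite /congruent_exponents.
have -> : [seq omega i y | y <- d i] = [seq omega i q.1 | q <- zip (d i) t].
  by rewrite -[in LHS](unzip1_zip (s := d i) (t := t)) ?st// -map_comp.
rewrite (count_box_prod (fun q => omega i q.1) (fun q a =>
  if omega i q.1 == 0%N then (g %| (a - q.2)%R)%Z else a == q.2)).
elim: (d i) t st rt wn => [|x s IH] [|a t] //=; first by rewrite big_nil.
move=> [st]; rewrite reduced_cons => /andP[xa rt] wn.
rewrite big_cons /= expnD leq_mul//; last first.
  by apply: IH => // y ys; apply: wn; rewrite inE ys orbT.
have := wn x (mem_head _ _); case: eqP xa => [->|w0] xa wxn.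
  by rewrite expn1; exact: count_congr_range.
rewrite expn0 -has_count; apply/hasP; exists a => //.
rewrite mem_exp_range xa /=; move: xa; rewrite /in_Zomega; case: eqP => //= _.
lia.
Qed.

(** The class t found at level i varies with the preceding exponents, but the number of its members
    in the box is bounded below independently of t; so the bounds of the levels multiply. *)
Lemma sat_count_ge n z j i u : size z = k -> (0 < gcds z)%N -> (0 < i)%N ->
  (i + j = c.+1)%N ->
  (forall i y, (0 < i <= c)%N -> y \in d i -> (omega i y <= n.+1)%N) ->
  has_exponents z u -> level_solution i u ->
  (\prod_(l <- iota i j) level_bound n (gcds z) l <=
   count (fun z1 => `[< SAT G c k (u * powprod (unzip1 (coefs i j)) z1)%g >])
     (box (unzip2 (coefs i j)) n))%N.
Proof.
move=> sz g0 + + wn; elim: j i u => [|j IH] i u i0 ij uz us.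
  rewrite big_nil /= addn0.
  have -> : `[< SAT G c k (u * powprod [::] [::])%g >] = true; last by [].
  rewrite powprod_nil mulg1; apply/asboolP; have [phi [phiC phiu]] := us.
  exists (fun l => phi (var l)), phi; split=> //.
  by move: phiu; rewrite -[i]addn0 ij Gc.
have ic : (0 < i <= c)%N by lia.
rewrite big_cons (levelsS _ i j).1 (levelsS _ i j).2.
have wE : [seq omega i y | y <- coef_base d b i] =
    [seq omega i y | y <- new_base b i] ++ [seq omega i y | y <- d i].
  rewrite /coef_base (map_cat _ (new_base b i)) -(map_comp _ _ (d i)); congr (_ ++ _).
  by apply: eq_map => y; rewrite /comp (omega_const k Gc).
rewrite wE -catA count_box_cat /level_bound.
set s := box [seq omega i y | y <- new_base b i] n.
rewrite -mulnA -sum1_size big_distrl big_seq [leqRHS]big_seq; apply: leq_sum => z0.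
rewrite mem_box size_map => /andP[/eqP sz0 _]; rewrite -[leqLHS]/(1 * _)%N mul1n.
rewrite count_box_cat.
have [t rt tP] := level_step ic sz sz0 uz us.
have st : size t = size (d i) by rewrite (reduced_size rt) size_map.
apply: leq_trans (leq_mul (congruent_count (n := n) g0 st rt (wn i ^~ ic)) (leqnn _)) _.
rewrite -sum1_count big_mkcond big_distrl big_seq [leqRHS]big_seq.
apply: leq_sum => z1; rewrite mem_box size_map => /andP[/eqP sz1 _].
case: ifPn => [tz1|_]; last by rewrite -[leqLHS]/(0 * _)%N.
rewrite -[leqLHS]/(1 * _)%N mul1n.
have [vz vs] := tP z1 sz1 tz1.
apply: leq_trans (IH i.+1 _ isT _ vz vs) _; first by rewrite addSnnS.
apply/eq_leq/eq_count => z2; congr asbool; congr (SAT G c k _).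
by rewrite catA -mulgA powprod_cat// !size_cat sz0 sz1 size_map.
Qed.

End LowerBound.

Section LowerFrequency.
Variables (G : groupType) (c k : nat).
Hypothesis c_gt0 : (0 < c)%N.
Hypothesis Gc : gamma G c.+1 = [set 1].
Local Notation GX := (eqn_group G c k).
Variables (d : nat -> seq G) (b : nat -> seq GX).
Hypothesis d_base : lower_central_base c d.
Hypothesis b_base : complement_base b.
Local Notation coefs := (levels (coef_base d b)).

Lemma level_ratio (R : realType) n q i :
  (forall y, y \in d i -> (omega i y <= n.+1)%N) ->
  ((q ^ count (fun y => omega i y == 0%N) (d i))%N%:R /
   (size (box [seq omega i y | y <- d i] n))%:R =
   (\prod_(y <- d i | omega i y != 0%N) omega i y)%N%:R^-1 *
     (q%:R / n.*2.+1%:R) ^+ count (fun y => omega i y == 0%N) (d i) :> R)%R.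
Proof.
rewrite size_box big_map; elim: (d i) => [|x s IH] wn.
  by rewrite !big_nil expn0 expr0 !mulr1n mulr1 divr1 invr1.
have {}IH := IH (fun y ys => wn y (mem_behead (s := x :: s) ys)).
have := wn x (mem_head _ _); rewrite !big_cons /= expnD !natrM invfM mulrACA IH exprD.
have [->|w0] := eqVneq (omega i x) 0%N => wx.
  by rewrite size_exp_range0 /= expn1 expr1 mulrCA.
rewrite size_exp_range ?lt0n ?w0// /= expn0 expr0 !mul1r natrM invfM.
by rewrite mulrA.
Qed.

(** The elements of [new_base] cancel, those of finite order in d give the inverse of the torsion,
    and those of infinite order give one factor each. *)
Lemma levels_ratio (R : realType) n g j i : (0 < i)%N -> (i + j = c.+1)%N ->
  (forall i y, (0 < i <= c)%N -> y \in d i -> (omega i y <= n.+1)%N) ->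
  ((\prod_(l <- iota i j) level_bound d b n g l)%N%:R /
   (size (box (unzip2 (coefs i j)) n))%:R =
   (\prod_(l <- iota i j) \prod_(y <- d l | omega l y != 0%N) omega l y)%N%:R^-1 *
   ((n.*2.+1 %/ g)%:R / n.*2.+1%:R) ^+
     count (fun w => w == 0%N) (unzip2 (levels d i j)) :> R)%R.
Proof.
move=> + + wn; elim: j i => [|j IH] i i0 ij.
  by rewrite !big_nil expr0 size_box big_nil !mulr1n mulr1 divr1 invr1.
have ic : (0 < i <= c)%N by lia.
rewrite (levelsS (coef_base d b) i j).2 (levelsS d i j).2 [iota i j.+1]/= !big_cons.
have -> : [seq omega i y | y <- coef_base d b i] =
    [seq omega i y | y <- new_base b i] ++ [seq omega i y | y <- d i].
  rewrite /coef_base (map_cat _ (new_base b i)) -(map_comp _ _ (d i)); congr (_ ++ _).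
  by apply: eq_map => y; rewrite /comp (omega_const k Gc).
rewrite size_box !big_cat -!size_box /level_bound count_cat count_map exprD.
set nb := size (box [seq omega i y | y <- new_base b i] n).
set T := (\prod_(y <- d i | _) _)%N; set T' := (\prod_(l <- iota i.+1 j) \prod_(y <- d l | _) _)%N.
have nb0 : (nb%:R : R)%R != 0%R.
  by rewrite pnatr_eq0 -lt0n /nb size_box prodn_gt0// => w; exact: size_exp_range_gt0.
rewrite -[(nb * _)%N]/(nb * _)%N !natrM.
transitivity (((n.*2.+1 %/ g) ^ count (fun y => omega i y == 0%N) (d i))%N%:R /
   (size (box [seq omega i y | y <- d i] n))%:R *
   ((\prod_(l <- iota i.+1 j) level_bound d b n g l)%N%:R /
   (size (box (unzip2 (coefs i.+1 j)) n))%:R) : R)%R.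
  have F (x q l s t : R) : (x != 0 -> q / s * (l / t) = x * q * l / (x * s * t))%R.
    by move=> x0; rewrite -(mulrA x q) -(mulrA x s) -[RHS]mulf_div divff// mul1r mulf_div.
  by rewrite (F _ _ _ _ _ nb0) ?mulrA.
rewrite level_ratio; last by move=> y; exact: wn.
rewrite IH// ?addSnnS// invfM mulrACA.
by [].
Qed.

Lemma rho_sat_ge (R : realType) n : (0 < k)%N ->
  (forall i y, (0 < i <= c)%N -> y \in d i -> (omega i y <= n.+1)%N) ->
  ((lc_torsion c d)%:R^-1 * (\sum_(0 <= i < n) gcd_freq R k n i.+1 *
     ((n.*2.+1 %/ i.+1)%:R / n.*2.+1%:R) ^+
       count (fun w => w == 0%N) (unzip2 (levels d 1 c))) <=
   rho (eqn_base d b) R (SAT G c k) n)%R.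
Proof.
move=> k0 wn; rewrite (rho_eqn_base c_gt0 Gc d_base b_base).
have lcE : lc_torsion c d =
    (\prod_(l <- iota 1 c) \prod_(y <- d l | omega l y != 0%N) omega l y)%N.
  by rewrite /lc_torsion /index_iota subSS subn0.
set h := count _ _; set s2 := size (box (unzip2 (coefs 1 c)) n).
have s20 : (s2%:R : R)%R != 0%R.
  by rewrite pnatr_eq0 -lt0n /s2 size_box prodn_gt0// => w; exact: size_exp_range_gt0.
have n0 : ((n.*2.+1)%:R ^+ k : R)%R != 0%R by rewrite expf_neq0 ?pnatr_eq0.
have -> : size (box (unzip2 (eqn_base d b)) n) = (n.*2.+1 ^ k * s2)%N.
  by rewrite (unzip2_eqn_base c_gt0) size_box big_cat -!size_box size_box0.
pose LB g := (\prod_(l <- iota 1 c) level_bound d b n g l)%N.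
have cE : (\sum_(0 <= i < n) gcd_count k n i.+1 * LB i.+1 <=
    count (fun z => `[< SAT G c k (powprod (unzip1 (eqn_base d b)) z) >])
      (box (unzip2 (eqn_base d b)) n))%N.
  rewrite (unzip2_eqn_base c_gt0) count_box_cat (sum_box_gcds _ _ k0) big_nat_recl//.
  apply: leq_trans (leq_addl _ _); apply: leq_sum => i _.
  rewrite /gcd_count -sum1_count big_distrl big_seq_cond [leqRHS]big_seq_cond.
  apply: leq_sum => z /andP[]; rewrite mem_box0 => /andP[/eqP sz _] /eqP gz.
  rewrite -[leqLHS]/(1 * _)%N mul1n.
  have := @sat_count_ge G c k c_gt0 Gc d b d_base b_base n z c 1%N (powprod (vars G c k) z) sz.
  rewrite gz => /(_ isT isT (add1n c) wn); rewrite -/(LB _).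
  have [phi [phiC _]] := retraction_exists (k := k) Gc (fun=> 1).
  move=> /(_ _ _) H; apply: leq_trans (H _ _) _ => //.
    by exists phi.
  apply/eq_leq/eq_count => z1; congr asbool; congr (SAT G c k _).
  by rewrite (unzip1_eqn_base c_gt0) powprod_cat ?size_vars.
rewrite natrM natrX; apply: le_trans (_ : (\sum_(0 <= i < n) gcd_count k n i.+1 * LB i.+1)%N%:R /
  (n.*2.+1%:R ^+ k * s2%:R) <= _)%R; last first.
  by rewrite ler_wpM2r ?invr_ge0 ?mulr_ge0 ?exprn_ge0 ?ler0n// ler_nat.
rewrite natr_sum mulr_suml mulr_sumr; apply: ler_sum => i _.
have := @levels_ratio R n i.+1 c 1%N isT (add1n c) wn; rewrite -/h -/s2 -lcE -/(LB i.+1) => E.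
rewrite mulrCA -E natrM /gcd_freq le_eqVlt; apply/orP; left; apply/eqP.
by field; rewrite s20 n0.
Qed.

End LowerFrequency.

(** The abelianization has trivial second term, so the image of [d 1] is a base for a series of
    length 1; passing once more to the quotient by that term is injective and preserves orders. *)
Lemma hirsch_length_abelianization (G : groupType) c (d : nat -> seq G) :
  (0 < c)%N -> lower_central_base c d ->
  hirsch_length (abelianization G) = count (fun y => omega 1%N y == 0%N) (d 1%N).
Proof.
move=> c0 d_base; have [dG dB] := d_basis d_base (c0 : (0 < 1 <= c)%N).
pose K := abelianization G; pose pi := coset (gammaN K 2).
have piM : {morph pi : x y / x * y} by exact: cosetM.
have piI x : pi x = 1 -> x = 1.
  by move=> /coset1P; rewrite /= [gamma K 2]gamma_quotient1.
rewrite (@hirsch_length_levels K 1%N (fun=> [seq coset (gammaN G 2) y | y <- d 1%N])).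
- rewrite (levelsS _ 1%N 0%N).2 cats0 -(map_comp _ _ (d 1%N)) count_map.
  apply: eq_count => y; rewrite /= !omegaE; congr (_ == _).
  exact: (morph_elt_order _ piM piI).
- exact: gamma_quotient1.
- case=> [//|[_|//]]; split=> //.
  have := basis_image piM piI dB; congr basis.
  apply/seteqP; split=> [_ [x _ <-]|_ [x _ <-]]; first by exists x.
  by exists x => //; exists (repr x) => //; exact: coset_repr.
Qed.

Local Open Scope ring_scope.

Theorem theorem3p4 (R : realType) (G : groupType) (c k : nat)
  (G_infinite : infinite_set [set: G])
  (G_fg : finitely_generated G)
  (G_class : nilpotency_class G c)
  (G_nonabelian : ~ (forall x y : G, commute x y))
  (k_ge2 : (2 <= k)%N)
  (d : nat -> seq G) (b : nat -> seq (eqn_group G c k))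
  (d_base : lower_central_base c d)
  (b_base : complement_base b) :
  (lc_torsion c d)%:R^-1 * (zeta R (k + hirsch_length G) / zeta R k)
    <= limn_inf (rho (eqn_base d b) R (SAT G c k))
  /\
  limn_sup (rho (eqn_base d b) R (SAT G c k))
    <= zeta R (k + hirsch_length (abelianization G)) / zeta R k.
Proof.
have [Gc _] := G_class; have k0 : (0 < k)%N by exact: ltnW.
(* Class 0 would make G trivial, hence abelian. *)
have c0 : (0 < c)%N.
  case: (c) Gc => // G1; case: G_nonabelian => x y.
  have E (z : G) : z = 1%g by have : gamma G 1 z by []; rewrite G1.
  by rewrite (E x) (E y).
split; last first.
  rewrite (hirsch_length_abelianization c0 d_base).
  apply: limn_sup_gcd_freq => // n; first exact: rho01.
  exact: rho_sat_le.
rewrite (hirsch_length_levels Gc (d_basis d_base)).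
apply: limn_inf_gcd_freq => //; first by move=> n; exact: rho01.
(* This sum bounds every [omega], so from here on the box contains all reduced exponents of the
   elements of finite order. *)
exists (\sum_(i <- iota 1 c) \sum_(y <- d i) omega i y)%N => // n /= Nn.
apply: rho_sat_ge => // i y ic yd; apply: leq_trans (leqW Nn).
rewrite (big_rem i) ?mem_iota ?add1n ?ltnS//= (big_rem y)//= -addnA.
exact: leq_addr.
Qed.
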